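(* The metric space $(\mathcal{X},\square)$ of mm-isomorphism classes of mm-spaces with the box distance is a geodesic space: for any $X_0,X_1\in\mathcal{X}$ there is a path $[0,1]\ni t\mapsto X_t\in\mathcal{X}$ with $\square(X_s,X_t)=|s-t|\,\square(X_0,X_1)$ for all $s,t\in[0,1]$. In particular, $\mathcal{X}$ is locally path connected in the box topology.
   Context: An mm-space is a triple $(X,d_X,\mu_X)$ where $(X,d_X)$ is a complete separable metric space and $\mu_X$ is a Borel probability measure on $X$. Two mm-spaces $X,Y$ are mm-isomorphic if there is an isometry $f\colon \operatorname{supp}\mu_X\to\operatorname{supp}\mu_Y$ with $f_*\mu_X=\mu_Y$; $\mathcal{X}$ is the set of mm-isomorphism classes. A parameter of $X$ is a Borel map $\varphi\colon [0,1)\to X$ with $\varphi_*\mathcal{L}^1=\mu_X$. The box distance $\square(X,Y)$ is the infimum of $\varepsilon\ge 0$ such that there exist parameters $\varphi$ of $X$, $\psi$ of $Y$ and a Borel set $I_0\subset[0,1)$ with $\mathcal{L}^1(I_0)\ge 1-\varepsilon$ and $|d_X(\varphi(s),\varphi(t))-d_Y(\psi(s),\psi(t))|\le\varepsilon$ for all $s,t\in I_0$; it is a metric on $\mathcal{X}$ and induces the box topology. *)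

(* Defs.v *)
From HB Require Import structures.
From mathcomp Require Import all_boot all_order all_algebra.
From mathcomp Require Import all_classical all_reals all_analysis.
Set Implicit Arguments. Unset Strict Implicit. Unset Printing Implicit Defensive.
Import Order.TTheory GRing.Theory Num.Theory.
Import numFieldNormedType.Exports.
Local Open Scope classical_set_scope.
Local Open Scope ring_scope.

Section MM.
Variable R : realType.

Definition dopen (T : Type) (d : T -> T -> R) (U : set T) : Prop :=
  forall x, U x -> exists e : R, 0 < e /\ [set y | d x y < e] `<=` U.

Definition dborel (T : Type) (d : T -> T -> R) : set (set T) :=
  <<s setT, [set U | dopen d U] >>.

Definition is_metric (T : Type) (d : T -> T -> R) : Prop :=
  (forall x y, d x y = 0 <-> x = y) /\
  (forall x y, d x y = d y x) /\
  (forall x y z, d x z <= d x y + d y z).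

Definition dcomplete (T : Type) (d : T -> T -> R) : Prop :=
  forall u : nat -> T,
    (forall e : R, 0 < e -> exists N : nat, forall m n : nat,
        (N <= m)%N -> (N <= n)%N -> d (u m) (u n) < e) ->
    exists x : T, forall e : R, 0 < e ->
      exists N : nat, forall n : nat, (N <= n)%N -> d (u n) x < e.

Definition dseparable (T : Type) (d : T -> T -> R) : Prop :=
  exists s : nat -> T, forall x e, 0 < e -> exists n, d x (s n) < e.

Definition borel_probability (T : Type) (d : T -> T -> R)
  (mu : set T -> \bar R) : Prop :=
  mu set0 = 0%E /\ mu setT = 1%E /\
  (forall B, dborel d B -> (0 <= mu B)%E) /\
  (forall F : nat -> set T, (forall n, dborel d (F n)) -> trivIset setT F ->
     (fun n => \sum_(k < n) mu (F k))%E @ \oo --> mu (\bigcup_n F n)).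

End MM.

Record mmspace (R : realType) := MMSpace {
  mm_car :> Type;
  mm_d : mm_car -> mm_car -> R;
  mm_mu : set mm_car -> \bar R;
  mm_metric : is_metric mm_d;
  mm_complete : dcomplete mm_d;
  mm_separable : dseparable mm_d;
  mm_prob : borel_probability mm_d mm_mu }.

Section Box.
Variable R : realType.

Definition unit_itv : set R := [set x | 0 <= x < 1].

Definition parameter (X : mmspace R) (phi : R -> X) : Prop :=
  (forall B, dborel (@mm_d R X) B ->
     measurable (unit_itv `&` phi @^-1` B)) /\
  (forall B, dborel (@mm_d R X) B ->
     lebesgue_measure (unit_itv `&` phi @^-1` B) = @mm_mu R X B).

Definition box_admissible (X Y : mmspace R) (e : R) : Prop :=
  0 <= e /\
  exists (phi : R -> X) (psi : R -> Y) (I0 : set R),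
    parameter phi /\ parameter psi /\
    measurable I0 /\ I0 `<=` unit_itv /\
    ((1 - e)%:E <= lebesgue_measure I0)%E /\
    (forall s t, I0 s -> I0 t ->
       `| mm_d (phi s) (phi t) - mm_d (psi s) (psi t) | <= e).

Definition box (X Y : mmspace R) : R := inf [set e | box_admissible X Y e].

End Box.

(* Main.v *)
Require Import Defs.
From HB Require Import structures.
From mathcomp Require Import all_boot all_order all_algebra.
From mathcomp Require Import all_classical all_reals all_analysis.
From mathcomp Require Import lra ring.
Set Implicit Arguments. Unset Strict Implicit. Unset Printing Implicit Defensive.
Import Order.TTheory GRing.Theory Num.Theory.
Import numFieldNormedType.Exports.
Local Open Scope classical_set_scope.
Local Open Scope ring_scope.

(* Cut complete separable spaces into countably many small Borel cells.  A point is then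
   coded by the sequence of the cells containing it, and a probability law on codes is a
   tree of weights; the corresponding tree of nested half-open intervals of [0, 1) turns
   such a law into a parameter.  This yields, by elementary means,
   - the existence of parameters;
   - the triangle inequality: if the Y-cell is the first letter of the codes, both
     reparametrisations use the same intervals for it, so they are glued up to the size
     of the cells;
   - the existence of optimal parameters: the fixed marginals make the trees tight, so
     weights of almost optimal trees converge along an ultrafilter to a tree.  As the
     first letter records membership in I_0, the limit has I_0 = [0, 1 - box).
   For the geodesic, embed X_0 and X_1 isometrically into a space of functions with the
   sup metric so that matched points are at distance at most box / 2.  In X_t the points
   with parameter in I_0 move linearly from X_0 to X_1, while outside I_0 they jump, the
   proportion that has jumped at time t being t.  Then box (X_s, X_t) <= |s - t| box, and
   equality follows from the triangle inequality. *)

(* Prefixes are stored backwards, the last letter first. *)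
Fixpoint prefix_of (c : nat -> nat) (k : nat) : seq nat :=
  if k is k'.+1 then c k' :: prefix_of c k' else [::].

Lemma size_prefix_of c k : size (prefix_of c k) = k.
Proof. by elim: k => //= k ->. Qed.

Lemma prefix_of_inj c c' k : prefix_of c k = prefix_of c' k ->
  forall j, (j < k)%N -> c j = c' j.
Proof.
elim: k => //= k IH [ck /IH cj] j; rewrite ltnS leq_eqVlt => /orP[/eqP->//|].
exact: cj.
Qed.

(** * Trees of weights and nested half-open intervals *)

Section Tree.
Variable R : realType.
Implicit Types (w : seq nat -> R) (s : R) (p : seq nat).

(** A probability law on codes: [w p] is the mass of the codes with prefix [p], and the countable
    sum over the next letter is a limit of partial sums. *)
Definition tree w := [/\ forall p, 0 <= w p, w [::] = 1 &
  forall p, (fun n => \sum_(i < n) w (nat_of_ord i :: p)) @ \oo --> w p].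

(** Left end of the interval of [p]: inside the interval of a word, its one-letter extensions are
    laid out from left to right in the order of the new letter. *)
Fixpoint start w p : R :=
  if p is i :: p' then start w p' + \sum_(j < i) w (nat_of_ord j :: p') else 0.

Definition cell w p : set R := [set s | start w p <= s < start w p + w p].

Definition child w p s : nat := xget 0%N [set i | cell w (i :: p) s].

Fixpoint node w s k : seq nat :=
  if k is k'.+1 then child w (node w s k') s :: node w s k' else [::].

Definition tree_code w s k := child w (node w s k) s.

Lemma node_prefix w s k : node w s k = prefix_of (tree_code w s) k.
Proof. by elim: k => //= k <-. Qed.

(** Glueing rests on this: equal first-level weights cut [0, 1) into the same first-level
    intervals. *)
Lemma code0_eq w w' s : (forall i, w [:: i] = w' [:: i]) ->
  tree_code w s 0 = tree_code w' s 0.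
Proof.
move=> ww'; rewrite /tree_code /child /=; congr xget; apply: eq_set => i.
by rewrite /cell /= ww'; under eq_bigr do rewrite ww'.
Qed.

Variable w : seq nat -> R.
Hypothesis wT : tree w.

Let w_ge0 p : 0 <= w p. Proof. by case: wT. Qed.

Lemma tree_partial_le p n : \sum_(i < n) w (nat_of_ord i :: p) <= w p.
Proof.
case: wT => _ _ /(_ p) wp.
rewrite -(cvg_lim _ wp)//.
apply: nondecreasing_cvgn_le; last by apply/cvg_ex; eexists; exact: wp.
by apply/nondecreasing_seqP => m; rewrite big_ord_recr /= lerDl.
Qed.

Lemma cell_sub i p : cell w (i :: p) `<=` cell w p.
Proof.
move=> s /andP[/= h1 h2].
have s0 : 0 <= \sum_(j < i) w (nat_of_ord j :: p) by apply: sumr_ge0.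
have := tree_partial_le p i.+1; rewrite big_ord_recr /= => h3.
by apply/andP; split; lra.
Qed.

Lemma cell_child p s : cell w p s -> exists i, cell w (i :: p) s.
Proof.
move=> /andP[h1 h2].
pose S n := \sum_(i < n) w (nat_of_ord i :: p).
have ex : exists n, s < start w p + S n.
  case: wT => _ _ /(_ p) wp.
  have : w p > s - start w p by lra.
  move=> /(cvgr_gt (w p) wp) [N _ /(_ N (leqnn N))] /= hN.
  by exists N; rewrite /S; lra.
(* The least [n] at which the partial sum passes [s] is one more than the letter sought. *)
case: (ex_minnP ex) => -[|n] hn nmin.
  by move: hn; rewrite /S big_ord0; lra.
exists n; rewrite /cell /=; apply/andP; split.
  rewrite leNgt; apply/negP => /nmin; by rewrite ltnn.
by move: hn; rewrite /S big_ord_recr /= addrA.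
Qed.

Lemma cell_inj i j p s : cell w (i :: p) s -> cell w (j :: p) s -> i = j.
Proof.
have mono a b : (a < b)%N ->
    \sum_(k < a.+1) w (nat_of_ord k :: p) <= \sum_(k < b) w (nat_of_ord k :: p).
  move=> /subnKC <-; rewrite -!(big_mkord xpredT (fun k => w (k :: p))).
  by rewrite (@big_cat_nat _ _ _ a.+1 0 (a.+1 + _)) ?leq_addr //= lerDl sumr_ge0.
move=> /andP[i1 i2] /andP[j1 j2].
move: i1 i2 j1 j2 => /= i1 i2 j1 j2.
case: (ltngtP i j) => // /mono; rewrite big_ord_recr /= => h; exfalso; lra.
Qed.

Lemma cell0 : cell w [::] = @unit_itv R.
Proof. by case: wT => _ w1 _; rewrite /cell /= w1 add0r. Qed.

Lemma cell_unit p : cell w p `<=` @unit_itv R.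
Proof. by elim: p => [|i p IH]; [rewrite cell0|move=> s /cell_sub /IH]. Qed.

Lemma childP p s : cell w p s -> cell w (child w p s :: p) s.
Proof. by move=> /cell_child; exact: xgetPex. Qed.

Lemma node_cell s k : unit_itv s -> cell w (node w s k) s.
Proof. by move=> us; elim: k => [|k IH] /=; [rewrite cell0|exact: childP]. Qed.

Lemma cell_node p s : cell w p s -> node w s (size p) = p.
Proof.
elim: p => //= i p IH h; have hp := cell_sub h.
rewrite IH //; congr cons; exact: cell_inj (childP hp) h.
Qed.

(** A half-open interval that contains a point has positive length, so no prefix read on [0, 1) is
    null. This later yields points that realise the prefix. *)
Lemma node_gt0 s k : unit_itv s -> 0 < w (prefix_of (tree_code w s) k).
Proof. rewrite -node_prefix => /(node_cell k) /andP[h1 h2]; lra. Qed.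

Lemma measurable_cell p : measurable (cell w p).
Proof.
rewrite (_ : cell w p = [set` `[start w p, start w p + w p[]) //.
Qed.

Lemma lebesgue_cell p : lebesgue_measure (cell w p) = (w p)%:E.
Proof.
rewrite (_ : cell w p = [set` `[start w p, start w p + w p[]); last first.
  by apply/seteqP; split => x /=; rewrite in_itv.
rewrite lebesgue_measure_itv /= lte_fin ltrDl; case: ltP => h.
  by rewrite -EFinD addrC addKr.
by congr EFin; apply/eqP; rewrite eq_le w_ge0 h.
Qed.

(** The set where letter [k] is [i] is split into intervals indexed by the words of length [k],
    numbered by [pickle]; a number that encodes no such word gives the empty set. *)
Definition code_cells (k i n : nat) : set R :=
  if pickle_inv n is Some p then
    if size (p : seq nat) == k then cell w (i :: p) else set0 else set0.

Lemma code_setE k i : @unit_itv R `&` [set s | tree_code w s k = i] =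
  \bigcup_n code_cells k i n.
Proof.
apply/seteqP; split => s.
  move=> [us /= ci]; exists (pickle (node w s k)) => //.
  rewrite /code_cells pickleK_inv node_prefix size_prefix_of eqxx -node_prefix -ci.
  exact: childP (node_cell k us).
move=> [n _]; rewrite /code_cells; case: pickle_inv => // p.
case: eqP => // <- h; split; first exact: cell_unit h.
have := cell_node h; by rewrite /= /tree_code => -[].
Qed.

Lemma measurable_code_cells k i n : measurable (code_cells k i n).
Proof.
rewrite /code_cells; case: pickle_inv => // p; case: ifP => // _.
exact: measurable_cell.
Qed.

Lemma measurable_code k i :
  measurable (@unit_itv R `&` [set s | tree_code w s k = i]).
Proof. by rewrite code_setE; apply: bigcupT_measurable => n; exact: measurable_code_cells. Qed.

Lemma trivIset_code_cells k i : trivIset setT (code_cells k i).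
Proof.
apply/trivIsetP => m n _ _ mn; apply/seteqP; split => // s [].
rewrite /code_cells.
case: (pickle_inv m) (@pickle_invK (seq nat) m) => // p /= pm.
case: (pickle_inv n) (@pickle_invK (seq nat) n) => // q /= qn.
case: eqP => // sp; case: eqP => // sq /cell_node hp /cell_node hq.
move: hp hq; rewrite /= sp sq => -[_ hp] [_ hq].
by move: mn; rewrite -pm -qn -hp -hq eqxx.
Qed.

(** Bounds the mass of the codes whose letter [k] is [i], in terms of finite sums so that the bound
    passes to limits of trees. *)
Definition marginal_le (v : seq nat -> R) k i (b : R) := forall L : seq (seq nat),
  uniq L -> all (fun p => size p == k) L -> \sum_(p <- L) v (i :: p) <= b.

Lemma code_marginal k i b : marginal_le w k i b ->
  (lebesgue_measure (@unit_itv R `&` [set s | tree_code w s k = i]) <= b%:E)%E.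
Proof.
move=> hb; rewrite code_setE.
rewrite measure_bigcup //=; last 2 first.
- by move=> n _; exact: measurable_code_cells.
- exact: trivIset_code_cells.
apply: lime_le.
  by apply: is_cvg_nneseries => n _ _; exact: measure_ge0.
near=> N.
pose L := [seq p <- pmap (@pickle_inv (seq nat)) (iota 0 N) | size p == k].
have -> : (\sum_(0 <= j < N | j \in [set: nat]) lebesgue_measure (code_cells k i j) =
    (\sum_(p <- L) w (i :: p))%:E)%E.
  rewrite /L big_filter -sumEFin.
  rewrite /index_iota subn0; elim: (iota 0 N) => [|j l IH]; first by rewrite !big_nil.
  rewrite big_cons in_setT IH /= {1}/code_cells.
  case: pickle_inv => [p|] /=; last by rewrite measure0 add0e.
  rewrite big_cons; case: eqP => _; last by rewrite measure0 add0e.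
  by rewrite lebesgue_cell.
rewrite lee_fin; apply: hb; last by apply/allP => p; rewrite mem_filter => /andP[].
rewrite filter_uniq //; apply: (pmap_uniq (g := pickle)); last exact: iota_uniq.
exact: pickle_invK.
Unshelve. all: by end_near. Qed.

End Tree.

(** * Trees from measurable codes *)

Section LawTree.
Variables (R : realType) (disp : measure_display) (T : measurableType disp).
Variable P : {measure set T -> \bar R}.
Hypothesis P1 : P setT = 1%E.

Lemma prob_fin_num A : measurable A -> P A \is a fin_num.
Proof.
move=> mA; rewrite ge0_fin_numE; last exact: measure_ge0.
apply: le_lt_trans (ltry 1); rewrite -P1; apply: le_measure => //; rewrite inE //.
Qed.

Lemma fine_prob_le A B : measurable A -> measurable B -> A `<=` B ->
  fine (P A) <= fine (P B).
Proof.
move=> mA mB AB; apply: fine_le; rewrite ?prob_fin_num //.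
by apply: le_measure; rewrite ?inE.
Qed.

Lemma fine_probU A B : measurable A -> measurable B -> A `&` B = set0 ->
  fine (P (A `|` B)) = fine (P A) + fine (P B).
Proof.
by move=> mA mB AB; rewrite measureU // fineD // prob_fin_num.
Qed.

Variable C : T -> nat -> nat.
Hypothesis mC : forall k i, measurable [set x | C x k = i].

Definition code_event (p : seq nat) := [set x | prefix_of (C x) (size p) = p].

Definition law_tree (p : seq nat) : R := fine (P (code_event p)).

Lemma code_event_cons i p :
  code_event (i :: p) = [set x | C x (size p) = i] `&` code_event p.
Proof.
apply/seteqP; split => x; rewrite /code_event /=; first by case.
by case=> -> ->.
Qed.

Lemma measurable_code_event p : measurable (code_event p).
Proof.
elim: p => [|i p IH]; last by rewrite code_event_cons; exact: measurableI.
by rewrite (_ : code_event _ = setT) //; apply/seteqP.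
Qed.
Hint Resolve measurable_code_event : core.

Lemma measurable_code_lt k n : measurable [set x | (C x k < n)%N].
Proof.
rewrite (_ : [set x | _] = \bigcup_(i in [set i | (i < n)%N]) [set x | C x k = i]).
  by apply: bigcup_measurable.
by apply/seteqP; split => [x /= h|x [i /= h /= ->//]]; exists (C x k).
Qed.

Lemma law_tree_partial p n : \sum_(i < n) law_tree (nat_of_ord i :: p) =
  fine (P (code_event p `&` [set x | (C x (size p) < n)%N])).
Proof.
elim: n => [|n IH].
  rewrite big_ord0 (_ : _ `&` _ = set0) ?measure0 //.
  by apply/seteqP; split => // x [_].
rewrite big_ord_recr /= IH /law_tree -fine_probU //.
- congr (fine (P _)); rewrite code_event_cons; apply/seteqP; split => x /=.
    by case=> [[h /ltnW ?]|[-> h]]; split.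
  by rewrite ltnS leq_eqVlt => -[? /orP[/eqP|]]; [right|left].
- by apply: measurableI => //; exact: measurable_code_lt.
- rewrite code_event_cons; apply/seteqP; split => // x /= [[_ h] [e _]].
  by rewrite e ltnn in h.
Qed.

(** The children left out lie in the event that the next letter is at least [n]. The bound depends
    on [p] only through its length, which later gives tightness. *)
Lemma law_tree_tail p n :
  law_tree p - \sum_(i < n) law_tree (nat_of_ord i :: p) <=
  1 - fine (P [set x | (C x (size p) < n)%N]).
Proof.
have mL := measurable_code_lt (size p) n.
have mG : measurable (~` [set x | (C x (size p) < n)%N]) by exact: measurableC.
rewrite law_tree_partial /law_tree.
have -> : P (code_event p) = P ((code_event p `&` [set x | (C x (size p) < n)%N]) `|`
    (code_event p `&` ~` [set x | (C x (size p) < n)%N])) by rewrite -setIUr setUv setIT.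
rewrite fine_probU; last 3 first.
- exact: measurableI.
- exact: measurableI.
- by rewrite setIACA setICr setI0.
rewrite addrC addKr -[1]/(fine 1%E) -P1 -(setUv [set x | (C x (size p) < n)%N]).
rewrite fine_probU // ?setICr // [leRHS]addrC addKr.
by apply: fine_prob_le => //; exact: measurableI.
Qed.

Lemma law_treeP : tree law_tree.
Proof.
split=> [p||p].
- exact/fine_ge0/measure_ge0.
- by rewrite /law_tree (_ : code_event _ = setT) ?P1 //; apply/seteqP.
pose F i := code_event (i :: p).
have tF : trivIset setT F.
  apply/trivIsetP => i j _ _ ij; apply/seteqP; split => // x [].
  rewrite /F !code_event_cons => -[/= xi _] [/= xj _].
  by rewrite -xi -xj eqxx in ij.
have UF : \bigcup_i F i = code_event p.
  apply/seteqP; split => [x [i _]|x px]; first by rewrite /F code_event_cons => -[].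
  by exists (C x (size p)) => //; rewrite /F code_event_cons; split.
have : (fun n => \sum_(0 <= i < n) P (F i))%E @ \oo --> P (\bigcup_i F i).
  apply: measure_semi_sigma_additive => //; first by move=> i; exact: measurable_code_event.
  by rewrite UF.
rewrite UF -[P (code_event p)]fineK ?prob_fin_num // => /fine_cvgP[_].
apply: cvg_trans; apply: near_eq_cvg; apply: nearW => n /=.
by rewrite -sum_fine ?big_mkord // => i _; rewrite /F prob_fin_num.
Qed.

Lemma law_tree_marginal k i : marginal_le law_tree k i (fine (P [set x | C x k = i])).
Proof.
move=> L uL /allP sL.
have [-> mL] : \sum_(p <- L) law_tree (i :: p) =
    fine (P ([set x | C x k = i] `&` [set x | prefix_of (C x) k \in L])) /\
    measurable [set x | prefix_of (C x) k \in L].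
  elim: L uL sL => [_ _|p L IH /= /andP[pL uL] sL].
    rewrite big_nil (_ : [set x | _ \in [::]] = set0) ?setI0 ?measure0 //.
    by apply/seteqP; split.
  have /eqP sp := sL p (mem_head _ _).
  have [q qL|IH1 IH2] := IH uL; first by apply: sL; rewrite inE qL orbT.
  have E : [set x | prefix_of (C x) k \in p :: L] =
     code_event p `|` [set x | prefix_of (C x) k \in L].
    apply/seteqP; split => x; rewrite /code_event /= inE sp.
      by move=> /orP[/eqP|]; [left|right].
    by move=> [->|->]; rewrite ?eqxx ?orbT.
  split; last by rewrite E; exact: measurableU.
  rewrite big_cons IH1 /law_tree code_event_cons sp E setIUr fine_probU //.
  - exact: measurableI.
  - exact: measurableI.
  - rewrite setIACA setIid; apply/seteqP; split => // x [_ [/=]].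
    by rewrite /code_event /= sp => -> pL'; rewrite pL' in pL.
by apply: fine_prob_le => //; exact: measurableI.
Qed.

Lemma law_tree_gt0 p : 0 < law_tree p -> (0 < P (code_event p))%E.
Proof. by rewrite /law_tree; case: (P _) => [r||] /=; rewrite ?lte_fin ?ltxx. Qed.

Lemma law_tree1 i : law_tree [:: i] = fine (P [set x | C x 0 = i]).
Proof.
rewrite /law_tree code_event_cons (_ : code_event [::] = setT) ?setIT //.
by apply/seteqP.
Qed.

End LawTree.

(** * Limits of trees along an ultrafilter *)

Section UltraLimit.
Variables (R : realType) (V : set_system nat).
Hypothesis VU : UltraFilter V.

(** By compactness of [0, 1] the image ultrafilter has a cluster point, and an ultrafilter converges
    to its cluster points. *)
Lemma ultra_cvg01 (f : nat -> R) : (forall n, 0 <= f n <= 1) ->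
  exists l : R, f @ V --> l.
Proof.
move=> f01.
have VP : ProperFilter V by exact: ultra_proper.
have : (f @ V) `[0, 1]%classic.
  change (V (f @^-1` `[0, 1]%classic)).
  rewrite (_ : f @^-1` _ = setT); first exact: filterT.
  by apply/seteqP; split => // n _; rewrite /= in_itv /=; exact: f01.
move=> /(@segment_compact R 0 1 (f @ V) _)[l [_ cl]].
exists l => A lA.
have [//|nA] := in_ultra_setVsetC (f @^-1` A) VU.
by have [x [? ?]] := cl (~` A) A nA lA.
Qed.

Variable w_ : nat -> seq nat -> R.
Hypothesis w_T : forall n, tree (w_ n).
Variable tau : nat -> nat -> R.
Hypothesis tau0 : forall k, tau k @ \oo --> (0 : R).
Hypothesis w_tau : forall n p N,
  w_ n p - \sum_(i < N) w_ n (nat_of_ord i :: p) <= tau (size p) N.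

Definition ultra_tree (p : seq nat) : R := lim ((fun n => w_ n p) @ V).

Lemma tree_le1 n p : 0 <= w_ n p <= 1.
Proof.
have [w0 w1 _] := w_T n; rewrite w0 /=; elim: p => [|i p IH]; first by rewrite w1.
apply: le_trans IH; have := tree_partial_le (w_T n) p i.+1; rewrite big_ord_recr /=.
by apply: le_trans; rewrite lerDr sumr_ge0.
Qed.

Lemma ultra_tree_cvg p : (fun n => w_ n p) @ V --> ultra_tree p.
Proof.
have VP : ProperFilter V by exact: ultra_proper.
have [l hl] := ultra_cvg01 (fun n => tree_le1 n p).
by rewrite /ultra_tree (cvg_lim _ hl).
Qed.

Lemma ultra_sum_cvg (I : Type) (L : seq I) (g : I -> seq nat) :
  (fun n => \sum_(i <- L) w_ n (g i)) @ V --> \sum_(i <- L) ultra_tree (g i).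
Proof.
have VP : ProperFilter V by exact: ultra_proper.
elim: L => [|i L IH]; first by under eq_fun do rewrite big_nil; rewrite big_nil; exact: cvg_cst.
under eq_fun do rewrite big_cons; rewrite big_cons; apply: cvgD IH; exact: ultra_tree_cvg.
Qed.

Lemma ultra_tree_marginal k i b : (forall n, marginal_le (w_ n) k i b) ->
  marginal_le ultra_tree k i b.
Proof.
have VP : ProperFilter V by exact: ultra_proper.
move=> hb L uL sL; apply: (@cvgr_to_le _ V VP _ _ _ b (@ultra_sum_cvg _ L (cons i))).
by apply: nearW => n; exact: hb.
Qed.

Lemma ultra_tree_gt0 p : 0 < ultra_tree p -> V [set n | 0 < w_ n p].
Proof.
have VP : ProperFilter V by exact: ultra_proper.
by move=> h; exact: (@cvgr_gt _ _ V _ _ _ (@ultra_tree_cvg p) _ h).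
Qed.

(** Finite sums pass to the limit, so partial sums stay below the weight of the parent; the tail
    bound [tau], uniform along the sequence of trees, keeps mass from escaping to ever larger
    letters. *)
Lemma ultra_treeP : tree ultra_tree.
Proof.
have VP : ProperFilter V by exact: ultra_proper.
split=> [p||p].
- apply: (@cvgr_to_ge _ V VP _ _ _ _ (@ultra_tree_cvg p)); apply: nearW => n.
  by have /andP[] := tree_le1 n p.
- apply/(cvg_lim (@Rhausdorff R)).
  rewrite (_ : (fun n => _) = fun=> 1); first exact: cvg_cst.
  by apply/funext => n; have [] := w_T n.
apply: (@squeeze_cvgr _ _ _ _ (fun N => ultra_tree p - tau (size p) N)
  (fun=> ultra_tree p)); last 2 first.
- rewrite -[X in _ --> X]subr0; apply: cvgB; [exact: cvg_cst|exact: tau0].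
- exact: cvg_cst.
apply: nearW => N; apply/andP; split.
  rewrite lerBlDr -lerBlDl.
  apply: (@cvgr_to_le _ V VP _ _ _ _ (cvgB (@ultra_tree_cvg p)
    (@ultra_sum_cvg _ _ (fun i : 'I_N => nat_of_ord i :: p)))).
  by apply: nearW => n; exact: w_tau.
rewrite -subr_ge0.
apply: (@cvgr_to_ge _ V VP _ _ _ _ (cvgB (@ultra_tree_cvg p)
  (@ultra_sum_cvg _ _ (fun i : 'I_N => nat_of_ord i :: p)))).
by apply: nearW => n /=; rewrite subr_ge0; exact: tree_partial_le.
Qed.

End UltraLimit.

(** * Borel measures on metric spaces *)

Section Borel.
Variables (R : realType) (T : Type) (d : T -> T -> R).

Definition pointed_at (x0 : T) : pointedType :=
  HB.pack T (gen_eqMixin T) (gen_choiceMixin T) (isPointed.Build T x0).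

Definition borel_type (x0 : T) : measurableType _ :=
  g_sigma_algebraType (T := pointed_at x0) [set U : set (pointed_at x0) | @dopen R T d U].

Lemma dborel_measurable (x0 : T) (B : set T) :
  dborel d B = measurable (B : set (borel_type x0)).
Proof. by []. Qed.

Lemma dborel_open U : dopen d U -> dborel d U.
Proof. by move=> oU; exact: sub_sigma_algebra. Qed.

(** [mu] is constrained on Borel sets only, while a measure has to be nonnegative on every set;
    hence the value 0 off the Borel sets. *)
Definition borel_measure (x0 : T) (mu : set T -> \bar R)
  (hmu : borel_probability d mu) (A : set (borel_type x0)) : \bar R :=
  if `[< dborel d A >] then mu A else 0%E.

Section Measure.
Variables (x0 : T) (mu : set T -> \bar R) (hmu : borel_probability d mu).

Let bm0 : borel_measure (x0 := x0) hmu set0 = 0%E.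
Proof. by rewrite /borel_measure; case: hmu => -> _; case: ifP. Qed.

Let bm_ge0 A : (0 <= borel_measure (x0 := x0) hmu A)%E.
Proof. by rewrite /borel_measure; case: asboolP => // bA; case: hmu => _ [_ [+ _]]; exact. Qed.

Let bm_sa : semi_sigma_additive (borel_measure (x0 := x0) hmu).
Proof.
move=> F mF tF mUF; rewrite /borel_measure asboolT //.
case: hmu => _ [_ [_ /(_ F mF tF)]]; apply: cvg_trans; apply: near_eq_cvg.
apply: nearW => n; rewrite big_mkord; apply: eq_bigr => i _.
by rewrite asboolT //; exact: mF.
Qed.

HB.instance Definition _ := isMeasure.Build _ (borel_type x0) R
  (borel_measure (x0 := x0) hmu) bm0 bm_ge0 bm_sa.

Definition borel_measure_of : {measure set (borel_type x0) -> \bar R} :=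
  borel_measure (x0 := x0) hmu.

Lemma borel_measureE B : dborel d B -> borel_measure_of B = mu B.
Proof. by move=> bB; rewrite /borel_measure_of /= /borel_measure asboolT. Qed.

Lemma borel_measureT : borel_measure_of setT = 1%E.
Proof.
rewrite borel_measureE; first by case: hmu => _ [].
exact: (@measurableT _ (borel_type x0)).
Qed.

End Measure.

Definition thicken (F : set T) (e : R) := [set x | exists2 y, F y & d x y < e].

Hypothesis dM : is_metric d.

Lemma is_metric_xx x : d x x = 0. Proof. by case: dM => /(_ x x)[_ ->]. Qed.

Lemma is_metric_sym x y : d x y = d y x. Proof. by case: dM => _ []. Qed.

Lemma is_metric_tri x y z : d x z <= d x y + d y z. Proof. by case: dM => _ []. Qed.

Lemma is_metric_ge0 x y : 0 <= d x y.
Proof.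
have := is_metric_tri x y x; rewrite is_metric_xx (is_metric_sym y x); lra.
Qed.

Lemma dopen_thicken F e : dopen d (thicken F e).
Proof.
move=> x [y Fy xy]; exists (e - d x y); split; first by rewrite subr_gt0.
move=> z /= xz; exists y => //; have := is_metric_tri z x y; rewrite (is_metric_sym z x); lra.
Qed.

Lemma dborel_thicken F e : dborel d (thicken F e).
Proof. by apply: dborel_open; exact: dopen_thicken. Qed.

Lemma dopen_ball x e : dopen d [set y | d y x < e].
Proof.
move=> y /= yx; exists (e - d y x); split; first by rewrite subr_gt0.
move=> z /= yz; have := is_metric_tri z y x; rewrite (is_metric_sym z y); lra.
Qed.

Lemma thicken_closed F : dopen d (~` F) ->
  \bigcap_n thicken F n.+1%:R^-1 = F.
Proof.
move=> oF; apply/seteqP; split => [x xF|x Fx n _]; last first.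
  by exists x => //; rewrite is_metric_xx invr_gt0.
apply: contrapT => /oF[e [e0 eF]].
have [n /= ne] := ltr_add_invr e0.
have [//|y Fy xy] := xF n.
by apply: (eF y) => //=; apply: lt_trans xy _; rewrite add0r in ne.
Qed.

Lemma thicken_cvg x0 (M : {measure set (borel_type x0) -> \bar R}) F a :
  M setT = 1%E -> dopen d (~` F) ->
  (forall n, (a <= M (thicken F n.+1%:R^-1))%E) -> (a <= M F)%E.
Proof.
move=> M1 oF aM.
have mT n : measurable (thicken F n.+1%:R^-1 : set (borel_type x0)).
  exact: dborel_thicken.
have mF : measurable (F : set (borel_type x0)).
  by rewrite -[F]setCK; apply: measurableC; exact: dborel_open.
have := @nonincreasing_cvg_mu _ (borel_type x0) _ M (fun n => thicken F n.+1%:R^-1).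
rewrite thicken_closed // => /(_ _ mT mF) cvM.
apply: (cvge_to_ge (cvM _ _)); last by apply: nearW => n; exact: aM.
- by rewrite -ge0_fin_numE ?(prob_fin_num M1) //; exact: measure_ge0.
- apply/nonincreasing_seqP => n; rewrite subsetEset => x [y Fy xy]; exists y => //.
  apply: lt_le_trans xy _; rewrite lef_pV2 ?posrE // ler_nat //.
Qed.

(** Closed sets are decreasing limits of their thickenings, so the hypothesis compares the measures
    on closed sets; as the total masses agree, the comparison reverses on complements. Equality on
    open sets, a generating class stable under intersection, extends to all Borel sets. *)
Lemma borel_probability_eq (x0 : T) (m1 m2 : set T -> \bar R) :
  borel_probability d m1 -> borel_probability d m2 ->
  (forall (F : set T) (e : R), dopen d (~` F) -> 0 < e -> (m1 F <= m2 (thicken F e))%E) ->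
  forall B, dborel d B -> m1 B = m2 B.
Proof.
move=> h1 h2 m12 B bB.
pose M1 := borel_measure_of x0 h1; pose M2 := borel_measure_of x0 h2.
have M1T : M1 setT = 1%E := borel_measureT x0 h1.
have M2T : M2 setT = 1%E := borel_measureT x0 h2.
have bF F : dopen d (~` F) -> dborel d F.
  move=> oF; rewrite (dborel_measurable x0) -[F]setCK; apply: measurableC.
  exact: dborel_open.
have le12 F : dopen d (~` F) -> (M1 F <= M2 F)%E.
  move=> oF; apply: thicken_cvg => // n; rewrite !borel_measureE //; last first.
  - exact: bF.
  - exact: dborel_thicken.
  by apply: m12 => //; rewrite invr_gt0.
have complE (M : {measure set (borel_type x0) -> \bar R}) V : M setT = 1%E -> dopen d V ->
    M V = (1 - M (~` V))%E.
  move=> MT /dborel_open; rewrite (dborel_measurable x0) => mV.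
  rewrite -MT -(setUv V) measureU ?setICr //; last exact: measurableC.
  by rewrite addeK // prob_fin_num //; exact: measurableC.
have le21 V : dopen d V -> (M2 V <= M1 V)%E.
  move=> oV; rewrite (complE M1 V) // (complE M2 V) // leeB //; apply: le12; by rewrite setCK.
(* The comparison on open sets, applied to the thickenings of a closed set, gives the reverse
   inequality on that set. *)
have le21' F : dopen d (~` F) -> (M2 F <= M1 F)%E.
  move=> oF; apply: thicken_cvg => // n; apply: le_trans (le21 _ _).
    apply: le_measure; rewrite ?inE; [exact: bF|exact: dborel_thicken|].
    by move=> x Fx; exists x => //; rewrite is_metric_xx invr_gt0.
  exact: dopen_thicken.
have <- : M1 B = m1 B by exact: borel_measureE.
have <- : M2 B = m2 B by exact: borel_measureE.
apply: (@measure_unique _ _ (borel_type x0) [set U | dopen d U] (fun=> setT)) => //.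
- move=> U V oU oV x [/oU[e1 [e10 h1']] /oV[e2 [e20 h2']]].
  exists (Num.min e1 e2); split; first by rewrite lt_min e10 e20.
  by move=> y /=; rewrite lt_min => /andP[/h1' ? /h2' ?].
- by move=> _ x _; exists 1.
- by rewrite bigcup_const.
- move=> V oV; rewrite (complE M1 V) // (complE M2 V) //; congr (1 - _)%E.
  by apply/eqP; rewrite eq_le le12 ?le21' ?setCK.
- by move=> _; rewrite M1T ltry.
Qed.

Section Law.
Variable phi : R -> T.

Lemma law_measurable :
  (forall U, dopen d U -> measurable (@unit_itv R `&` phi @^-1` U)) ->
  forall B, dborel d B -> measurable (@unit_itv R `&` phi @^-1` B).
Proof.
move=> oU; apply: smallest_sub => //; split.
- by rewrite /= preimage_set0 setI0.
- move=> A /= mA; rewrite setTD preimage_setC.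
  rewrite (_ : _ `&` _ = @unit_itv R `\` (@unit_itv R `&` phi @^-1` A)); last first.
    by rewrite setDIr setDv set0U setDE.
  apply: measurableD => //.
  rewrite (_ : @unit_itv R = [set` `[0, 1[]) //.
- move=> F mF; rewrite preimage_bigcup setI_bigcupr; exact: bigcupT_measurable.
Qed.

Lemma law_borel_probability :
  (forall B, dborel d B -> measurable (@unit_itv R `&` phi @^-1` B)) ->
  borel_probability d (fun B => lebesgue_measure (@unit_itv R `&` phi @^-1` B)).
Proof.
move=> mphi; split; first by rewrite preimage_set0 setI0 measure0.
split.
  rewrite preimage_setT setIT (_ : @unit_itv R = [set` `[0, 1[]) //.
  by rewrite lebesgue_measure_itv /= lte01 -EFinB subr0.
split=> [B _|F bF tF]; first exact: measure_ge0.
under eq_fun do rewrite -(big_mkord xpredT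
  (fun k => lebesgue_measure (@unit_itv R `&` phi @^-1` (F k)))).
rewrite preimage_bigcup setI_bigcupr.
apply: measure_sigma_additive; first by move=> n; apply: mphi; exact: bF.
apply/trivIsetP => i j _ _ ij; move/trivIsetP : tF => /(_ i j Logic.I Logic.I ij) Fij.
by rewrite setIACA setIid -preimage_setI Fij preimage_set0 setI0.
Qed.

(** The preimage of an open set is the countable union of those level sets of the approximating maps
    for which the ball around the value lies in the open set. *)
Lemma approx_measurable (I : countType) :
  (forall e : R, 0 < e -> exists (c : R -> I) (z : I -> T),
     (forall i, measurable (@unit_itv R `&` [set s | c s = i])) /\
     (forall s, unit_itv s -> d (phi s) (z (c s)) < e)) ->
  forall B, dborel d B -> measurable (@unit_itv R `&` phi @^-1` B).
Proof.
move=> appr; apply: law_measurable => V oV.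
have /choice[cz czP] n : exists cz : (R -> I) * (I -> T),
     (forall i, measurable (@unit_itv R `&` [set s | cz.1 s = i])) /\
     (forall s, unit_itv s -> d (phi s) (cz.2 (cz.1 s)) < n.+1%:R^-1).
  by have [|c [z ?]] := appr n.+1%:R^-1; [rewrite invr_gt0|exists (c, z)].
pose G (ni : nat * I) : set R :=
  if `[< [set y | d y ((cz ni.1).2 ni.2) < ni.1.+1%:R^-1] `<=` V >] then
    @unit_itv R `&` [set s | (cz ni.1).1 s = ni.2] else set0.
rewrite (_ : _ `&` _ = \bigcup_ni G ni).
  apply: countable_bigcupT_measurable; first exact: countableP.
  by move=> [n i]; rewrite /G; case: asboolP => // _; exact: (czP n).1.
apply/seteqP; split => [s [us Vs]|s [[n i] _]]; last first.
  rewrite /G; case: asboolP => //= hV [us e]; split => //; apply: hV => /=.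
  by rewrite -e; exact: (czP n).2.
have [e [e0 eV]] := oV _ Vs.
have [n /= ne] := ltr_add_invr (divr_gt0 e0 (ltr0Sn R 1)).
exists (n, (cz n).1 s) => //; rewrite /G /= asboolT //.
move=> y /= hy; apply: eV => /=.
have hs := (czP n).2 _ us.
have := is_metric_tri (phi s) ((cz n).2 ((cz n).1 s)) y.
rewrite (is_metric_sym ((cz n).2 _) y).
move: ne hy hs; rewrite add0r; move: (n.+1%:R^-1 : R) => q; lra.
Qed.

End Law.
End Borel.

Lemma exp2V_small (R : realType) (e : R) : 0 < e -> exists k : nat, 2 ^- k < e.
Proof.
move=> e0; have [k /= ke] := ltr_add_invr e0; exists k.+1; rewrite add0r in ke.
apply: le_lt_trans ke; rewrite lef_pV2 ?posrE ?exprn_gt0 // -natrX ler_nat.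
by rewrite ltnW //; exact: ltn_expl.
Qed.

Lemma unit_itv_measurable (R : realType) : measurable (@unit_itv R).
Proof. by rewrite (_ : @unit_itv R = [set` `[0, 1[]). Qed.

(** * Cells of a metric measure space and parameters read from codes *)

Section Coding.
Variables (R : realType) (X : mmspace R).
Local Notation d := (@mm_d R X).

Let dM : is_metric d := mm_metric X.

Definition dense_pt : nat -> X := projT1 (cid (mm_separable X)).

Lemma dense_ptP x e : 0 < e -> exists n, d x (dense_pt n) < e.
Proof. exact: (projT2 (cid (mm_separable X))). Qed.

Lemma dense_pt_near k x : exists n, d x (dense_pt n) < 2 ^- k.
Proof. by apply: dense_ptP; rewrite invr_gt0 exprn_gt0. Qed.

(** Taking the least index turns the cover by balls of radius [2 ^- k] into a countable Borel
    partition. *)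
Definition cell_idx (k : nat) (x : X) : nat := ex_minn (dense_pt_near k x).

Lemma cell_idxP k x : d x (dense_pt (cell_idx k x)) < 2 ^- k.
Proof. by rewrite /cell_idx; case: ex_minnP. Qed.

Lemma cell_idx_borel k i : dborel d [set x | cell_idx k x = i].
Proof.
rewrite (_ : [set x | _] = [set x | d x (dense_pt i) < 2 ^- k] `\`
   \bigcup_(j in [set j | (j < i)%N]) [set x | d x (dense_pt j) < 2 ^- k]).
  rewrite (dborel_measurable d (dense_pt 0)); apply: measurableD.
    by apply: dborel_open; exact: dopen_ball.
  by apply: bigcup_measurable => j _; apply: dborel_open; exact: dopen_ball.
apply/seteqP; split => x /=; rewrite /cell_idx; case: ex_minnP => m hm minm.
  by move=> <-; split => // -[j /= jm /minm]; rewrite leqNgt jm.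
move=> [hi nj]; apply/eqP; rewrite eqn_leq minm //= leqNgt; apply/negP => mi.
by apply: nj; exists m.
Qed.

Lemma cell_idx_lt_borel k n : dborel d [set x | (cell_idx k x < n)%N].
Proof.
rewrite (_ : [set x | _] =
    \bigcup_(i in [set i | (i < n)%N]) [set x | cell_idx k x = i]).
  rewrite (dborel_measurable d (dense_pt 0)).
  by apply: bigcup_measurable => i _; exact: cell_idx_borel.
by apply/seteqP; split => [x /= h|x [i /= h /= ->//]]; exists (cell_idx k x).
Qed.

(* The law of [phi] gives a closed set at most the mass that [mm_mu] gives to any
   neighbourhood of it; for probability measures this forces equality. *)
Lemma code_parameter (c : R -> nat -> nat) :
  (forall k i, measurable (@unit_itv R `&` [set s | c s k = i])) ->
  (forall k i, (lebesgue_measure (@unit_itv R `&` [set s | c s k = i]) <=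
                mm_mu [set x : X | cell_idx k x = i])%E) ->
  (forall s k, unit_itv s ->
     exists x : X, forall j, (j <= k)%N -> cell_idx j x = c s j) ->
  exists phi : R -> X, parameter phi /\
    forall s k, unit_itv s -> d (phi s) (dense_pt (c s k)) <= 2 * 2 ^- k.
Proof.
move=> mc cmu creal.
have tri := is_metric_tri dM; have sym := is_metric_sym dM.
(* A common point of the cells up to level [k] is close to both centres, so the centres along a code
   form a Cauchy sequence. *)
have step s j k : unit_itv s -> (j <= k)%N ->
    d (dense_pt (c s j)) (dense_pt (c s k)) < 2 * 2 ^- j.
  move=> us jk; have [x xc] := creal s k us.
  have h1 := cell_idxP j x; have h2 := cell_idxP k x.
  rewrite xc // in h1; rewrite xc // in h2.
  have h3 : 2 ^- k <= 2 ^- j :> R.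
    by rewrite lef_pV2 ?posrE ?exprn_gt0 // ler_eXn2l // ltr1n.
  have := tri (dense_pt (c s j)) x (dense_pt (c s k)).
  rewrite (sym _ x); lra.
have /choice[phi phiP] s : exists y : X,
    unit_itv s -> forall k, d y (dense_pt (c s k)) <= 2 * 2 ^- k.
  have [us|nus] := pselect (unit_itv s); last by exists (dense_pt 0).
  have [|y yP] := @mm_complete R X (fun k => dense_pt (c s k)).
    move=> e e0; have [N hN] := exp2V_small (divr_gt0 e0 (ltr0Sn R 3)).
    exists N => m n Nm Nn.
    have h1 := step s N m us Nm; have h2 := step s N n us Nn.
    have := tri (dense_pt (c s m)) (dense_pt (c s N)) (dense_pt (c s n)).
    rewrite (sym (dense_pt (c s m)) (dense_pt (c s N))); lra.
  exists y => _ k; apply/ler_addgt0Pr => e e0; have [N hN] := yP e e0.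
  have h1 := step s k (maxn k N) us (leq_maxl _ _).
  have h2 := hN (maxn k N) (leq_maxr _ _).
  have := tri y (dense_pt (c s (maxn k N))) (dense_pt (c s k)).
  rewrite (sym y (dense_pt (c s (maxn k N)))).
  rewrite (sym (dense_pt (c s (maxn k N))) (dense_pt (c s k))); lra.
exists phi; split; last by move=> s k us; exact: phiP.
have mphi : forall B, dborel d B -> measurable (@unit_itv R `&` phi @^-1` B).
  apply: (@approx_measurable R X d dM phi nat) => e e0.
  have [k hk] := exp2V_small (divr_gt0 e0 (ltr0Sn R 2)).
  exists (fun s => c s k), dense_pt; split=> // s us.
  have := phiP s us k; lra.
split=> //.
apply: (borel_probability_eq dM (dense_pt 0) (law_borel_probability mphi) (mm_prob X)).
move=> F e oF e0; have [k hk] := exp2V_small (divr_gt0 e0 (ltr0Sn R 2)).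
(* The level [k] parts of the code with index in [A] cover the preimage of [F], and the cells with
   index in [A] lie within [3 * 2 ^- k < e] of [F]. *)
pose A := [set i | exists2 y, F y & d (dense_pt i) y <= 2 * 2 ^- k].
have bF : dborel d F.
  rewrite (dborel_measurable d (dense_pt 0)) -[F]setCK; apply: measurableC.
  exact: dborel_open.
apply: (@le_trans _ _ (lebesgue_measure (\bigcup_(i in A) (@unit_itv R `&` [set s | c s k = i])))).
  apply: le_measure; rewrite ?inE; [exact: mphi|by apply: bigcup_measurable => i _; exact: mc|].
  move=> s [us Fs]; exists (c s k) => //; exists (phi s) => //.
  by rewrite sym; exact: phiP.
pose M := borel_measure_of (dense_pt 0) (mm_prob X).
have mI i : measurable ([set x | cell_idx k x = i] : set (borel_type d (dense_pt 0))).
  exact: cell_idx_borel.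
apply: (@le_trans _ _ (M (\bigcup_(i in A) [set x | cell_idx k x = i]))).
  rewrite !measure_bigcup //.
  - apply: lee_nneseries => [i _ _|i _]; first exact: measure_ge0.
    by rewrite /M borel_measureE; [exact: cmu|exact: cell_idx_borel].
  - apply/trivIsetP => i j _ _ ij; apply/seteqP; split => // x [/= xi xj].
    by rewrite -xi -xj eqxx in ij.
  - by move=> i _; exact: mc.
  - apply/trivIsetP => i j _ _ ij; apply/seteqP; split => // x [[_ /= xi] [_ /= xj]].
    by rewrite -xi -xj eqxx in ij.
rewrite -(borel_measureE (dense_pt 0) (mm_prob X)); last exact: dborel_thicken.
apply: le_measure; rewrite ?inE.
- by apply: bigcup_measurable => i _; exact: mI.
- exact: dborel_thicken.
move=> x [i [y Fy yi] /= xi]; exists y => //.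
have h1 := cell_idxP k x; rewrite xi in h1.
have := tri x (dense_pt i) y; lra.
Qed.

(** Take the law of the cell sequence under the given measure: events of positive mass are nonempty,
    so each prefix read from the tree is realised by a point. *)
Lemma parameter_exists : exists phi : R -> X, parameter phi.
Proof.
pose M := borel_measure_of (dense_pt 0) (mm_prob X).
have M1 : M setT = 1%E := borel_measureT _ _.
pose C (x : borel_type d (dense_pt 0)) k := cell_idx k x.
have mC k i : measurable [set x | C x k = i] by exact: cell_idx_borel.
pose w := law_tree M C.
have wT : tree w by exact: law_treeP.
have [||s k us|phi [? _]] := @code_parameter (tree_code w); last by exists phi.
- by move=> k i; exact: measurable_code.
- move=> k i; apply: le_trans (code_marginal wT (@law_tree_marginal _ _ _ M M1 C mC k i)) _.
  by rewrite fineK ?prob_fin_num // borel_measureE //; exact: cell_idx_borel.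
have /law_tree_gt0 := node_gt0 wT k.+1 us.
have [->|/set0P[x]] := eqVneq (code_event C (prefix_of (tree_code w s) k.+1)) set0.
  by rewrite measure0 ltxx.
rewrite /code_event /= size_prefix_of => xe _; exists x => j jk.
exact: (@prefix_of_inj (C x) (tree_code w s) k.+1 xe j).
Qed.

End Coding.

(** * Recoding a parametrisation of the unit interval *)

Section UnitCode.
Variable R : realType.
Local Notation U := (@unit_itv R).
Local Notation leb := (@lebesgue_measure R).

Lemma lebesgue_unit : leb U = 1%E.
Proof.
rewrite (_ : @unit_itv R = [set` `[0, 1[]) //.
by rewrite lebesgue_measure_itv /= lte01 -EFinB subr0.
Qed.

Definition unit_prob : {measure set (measurableTypeR R) -> \bar R} :=
  mrestr leb (@unit_itv_measurable R).

Lemma unit_probE A : unit_prob A = leb (U `&` A).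
Proof. by rewrite /unit_prob /= /mrestr setIC. Qed.

Lemma unit_probT : unit_prob setT = 1%E.
Proof. by rewrite unit_probE setIT lebesgue_unit. Qed.

Lemma leb_unit_fin A : measurable (U `&` A) -> leb (U `&` A) \is a fin_num.
Proof.
move=> mA; have -> : leb (U `&` A) = unit_prob (U `&` A).
  by rewrite unit_probE setIA setIid.
exact: (prob_fin_num unit_probT).
Qed.

Variable C : R -> nat -> nat.
Hypothesis mC : forall k i, measurable (U `&` [set s | C s k = i]).

(** The value 0 off [0, 1) makes the letters measurable on the whole line, as [law_tree] requires;
    [unit_prob] has no mass there. *)
Definition unit_code (s : R) k := if 0 <= s < 1 then C s k else 0%N.

Lemma unit_codeE s : U s -> unit_code s = C s.
Proof. by rewrite /unit_itv /= => us; apply/funext => k; rewrite /unit_code us. Qed.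

Lemma unit_setI (P Q : R -> Prop) : (forall s, U s -> P s <-> Q s) ->
  U `&` [set s | P s] = U `&` [set s | Q s].
Proof. by move=> PQ; apply/seteqP; split => s [us /= /(PQ s us)]. Qed.

Lemma measurable_unit_code k i : measurable [set s | unit_code s k = i].
Proof.
have -> : [set s | unit_code s k = i] = (U `&` [set s | C s k = i]) `|`
    (if i == 0%N then ~` U else set0).
  apply/seteqP; split => s.
    rewrite /unit_code /=; case: ifP => [us e|us <-]; first by left.
    by right; rewrite eqxx /unit_itv /= us.
  move=> [[us /=]|]; first by rewrite /unit_code us.
  case: eqP => // -> nus; rewrite /unit_code /=; case: ifP => // us.
apply: measurableU => //; case: eqP => // _.
by apply: measurableC; exact: unit_itv_measurable.
Qed.

Definition unit_tree := law_tree unit_prob unit_code.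

Lemma unit_treeP : tree unit_tree.
Proof. by apply: law_treeP; [exact: unit_probT|exact: measurable_unit_code]. Qed.

Lemma unit_tree_marginal k i :
  marginal_le unit_tree k i (fine (leb (U `&` [set s | C s k = i]))).
Proof.
rewrite (_ : leb _ = unit_prob [set s | unit_code s k = i]).
  by apply: law_tree_marginal; [exact: unit_probT|exact: measurable_unit_code].
rewrite unit_probE; congr leb; apply: unit_setI => s us.
by rewrite unit_codeE.
Qed.

Lemma unit_tree_ex p : 0 < unit_tree p ->
  exists s, U s /\ prefix_of (C s) (size p) = p.
Proof.
move=> /law_tree_gt0; rewrite unit_probE.
have [->|/set0P[s [us e]] _] := eqVneq (U `&` code_event unit_code p) set0.
  by rewrite measure0 ltxx.
by exists s; split=> //; rewrite -unit_codeE.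
Qed.

Lemma unit_tree1 i : unit_tree [:: i] = fine (leb (U `&` [set s | C s 0 = i])).
Proof.
rewrite /unit_tree law_tree1 unit_probE; congr (fine (leb _)).
by apply: unit_setI => s us; rewrite unit_codeE.
Qed.

Lemma unit_tree_tail p n :
  unit_tree p - \sum_(i < n) unit_tree (nat_of_ord i :: p) <=
  1 - fine (leb (U `&` [set s | (C s (size p) < n)%N])).
Proof.
rewrite (_ : leb _ = unit_prob [set s | (unit_code s (size p) < n)%N]).
  by apply: law_tree_tail; [exact: unit_probT|exact: measurable_unit_code].
rewrite unit_probE; congr leb; apply: unit_setI => s us.
by rewrite unit_codeE.
Qed.

(** Every finite part of a new code already occurs in the old coding, which transfers distance
    estimates at finite precision. *)
Lemma unit_tree_real s k : U s ->
  exists s', U s' /\ forall j, (j < k)%N -> C s' j = tree_code unit_tree s j.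
Proof.
move=> us; have [s' []] := unit_tree_ex (node_gt0 unit_treeP k us).
rewrite size_prefix_of => us' e; exists s'; split=> //; exact: prefix_of_inj.
Qed.

(** [h] picks the letters recording cells of [X] in a code that carries other data as well;
    monotonicity puts the letters [h 0] to [h k] inside one prefix. *)
Lemma unit_tree_parameter (X : mmspace R) (h : nat -> nat) (phi : R -> X) :
  parameter phi -> {homo h : i j / (i <= j)%N} ->
  (forall s j, U s -> C s (h j) = cell_idx j (phi s)) ->
  exists phi' : R -> X, parameter phi' /\ forall s k, U s ->
    mm_d (phi' s) (dense_pt X (tree_code unit_tree s (h k))) <= 2 * 2 ^- k.
Proof.
move=> [mphi lphi] hh Ch.
apply: (@code_parameter R X (fun s k => tree_code unit_tree s (h k))).
- move=> k i; apply: measurable_code; exact: unit_treeP.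
- move=> k i.
  have /le_trans := code_marginal unit_treeP (@unit_tree_marginal (h k) i).
  apply; rewrite fineK; last exact: leb_unit_fin.
  rewrite -lphi; last exact: cell_idx_borel.
  by rewrite (@unit_setI _ (fun s => cell_idx k (phi s) = i)) // => s us; rewrite Ch.
- move=> s k us; have [s' [us' e]] := unit_tree_real (h k).+1 us.
  exists (phi s') => j jk; rewrite -Ch // e // ltnS; exact: hh.
Qed.

End UnitCode.

(** * Reparametrisation with a prescribed first letter *)

Section Glue.
Variable R : realType.
Local Notation U := (@unit_itv R).
Local Notation leb := (@lebesgue_measure R).

Definition bit (I : set R) (s : R) : nat := if `[< I s >] then 0 else 1.

Lemma measurable_bit I i : measurable I -> measurable (U `&` [set s | bit I s = i]).
Proof.
move=> mI; have mU := @unit_itv_measurable R; rewrite /bit.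
case: i => [|[|i]].
- rewrite (_ : [set s | _] = I); first exact: measurableI.
  by apply/seteqP; split => s /=; case: asboolP.
- rewrite (_ : [set s | _] = ~` I); first by apply: measurableI => //; exact: measurableC.
  by apply/seteqP; split => s /=; case: asboolP.
- rewrite (_ : [set s | _] = set0) ?setI0 //.
  by apply/seteqP; split => s //=; case: asboolP.
Qed.

Lemma parameter_cell (X : mmspace R) (phi : R -> X) k i : parameter phi ->
  measurable (U `&` [set s | cell_idx k (phi s) = i]).
Proof. by case=> mphi _; apply: (mphi [set x | cell_idx k x = i]); exact: cell_idx_borel. Qed.

(** The cell of [Y] comes first, so that its intervals do not depend on the other letters. *)
Definition glue_code (X Y : mmspace R) (phi : R -> X) (psi : R -> Y) I K s k :=
  match k with
  | 0 => cell_idx K (psi s)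
  | 1 => bit I s
  | k'.+2 => cell_idx k' (phi s)
  end.

Variables (X Y : mmspace R) (phi : R -> X) (psi : R -> Y) (I : set R) (K : nat) (e : R).
Hypotheses (Pphi : parameter phi) (Ppsi : parameter psi).
Hypotheses (mI : measurable I) (IU : I `<=` U) (Ie : ((1 - e)%:E <= leb I)%E).

Let C := glue_code phi psi I K.
Let w := unit_tree C.

Let mC k i : measurable (U `&` [set s | C s k = i]).
Proof.
case: k => [|[|k]]; [exact: parameter_cell|exact: measurable_bit|exact: parameter_cell].
Qed.

(** These weights depend only on [Y] and [K], so they agree for two glueings over the same [Y]. *)
Lemma glue_tree1 i : w [:: i] = fine (mm_mu [set y : Y | cell_idx K y = i]).
Proof.
rewrite /w unit_tree1 /C /=; congr fine; case: Ppsi => _; apply.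
exact: cell_idx_borel.
Qed.

Lemma measurable_glue_set : measurable (U `&` [set s | tree_code w s 1 = 0%N]).
Proof. by apply: measurable_code; exact: unit_treeP. Qed.

Lemma glue_set_ge : ((1 - e)%:E <= leb (U `&` [set s | tree_code w s 1 = 0%N]))%E.
Proof.
have m0 := measurable_glue_set.
have m1 : measurable (U `&` [set s | tree_code w s 1 = 1%N]).
  by apply: measurable_code; exact: unit_treeP.
have UE : U = (U `&` [set s | tree_code w s 1 = 0%N]) `|` (U `&` [set s | tree_code w s 1 = 1%N]).
  apply/seteqP; split => [s us|s [[]|[]]//].
  have [s' [us' /(_ 1%N isT)]] := unit_tree_real mC 2 us.
  rewrite /C /= /bit; case: asboolP => _ <-; by [left|right].
(* Marginals give upper bounds only, so the set with bit 1 is bounded above and the set with bit 0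
   is its complement. *)
have l1 : (leb (U `&` [set s | tree_code w s 1 = 1%N]) <= e%:E)%E.
  have mb : measurable (U `&` [set s | bit I s = 1%N]) by exact: measurable_bit.
  apply: le_trans (code_marginal (unit_treeP mC) (@unit_tree_marginal _ _ mC 1 1)) _.
  rewrite fineK /=; last exact: leb_unit_fin.
  have : leb U = (leb I + leb (U `&` [set s | bit I s = 1%N]))%E.
    rewrite -measureU //.
      congr leb; apply/seteqP; split => [s us|s [/IU|[]]//].
      by have [Is|nIs] := pselect (I s); [left|right; split => //=; rewrite /bit asboolF].
    by apply/seteqP; split => // s [Is [_]]; rewrite /= /bit asboolT.
  rewrite lebesgue_unit.
  move: Ie (leb_unit_fin mb); case: (leb I) => [r||] //; case: (leb _) => [q||] //=.
  by rewrite !lee_fin => h _ [] h2; lra.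
have : leb U = (leb (U `&` [set s | tree_code w s 1 = 0%N]) +
    leb (U `&` [set s | tree_code w s 1 = 1%N]))%E.
  rewrite [in LHS]UE measureU //.
  by apply/seteqP; split => // s [[_ /= ->] []].
rewrite lebesgue_unit.
move: l1 (leb_unit_fin m0) (leb_unit_fin m1).
case: (leb _) => [r||] //; case: (leb _) => [q||] //=.
by rewrite !lee_fin => h _ _ [] h2; lra.
Qed.

Lemma glue_side : exists phi' : R -> X, parameter phi' /\
  forall s, (U `&` [set s | tree_code w s 1 = 0%N]) s ->
  exists2 s', I s' & mm_d (phi' s) (phi s') <= 3 * 2 ^- K /\
    cell_idx K (psi s') = tree_code w s 0.
Proof.
have dM := mm_metric X.
have [||phi' [Pphi' phi'P]] := unit_tree_parameter mC (h := fun j => j.+2) Pphi.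
- by move=> i j; rewrite !ltnS.
- by [].
exists phi'; split=> // s [us s1].
(* Length [K.+3] covers the cell of [Y], the bit, and the cells of [X] up to level [K], the last
   being letter [K.+2]. *)
have [s' [us' s'E]] := unit_tree_real mC K.+3 us.
exists s'.
  have := s'E 1%N isT; rewrite /C /= /bit -/w s1; by case: asboolP.
split; last exact: (s'E 0%N isT).
have h1 := phi'P s K us; have h2 := cell_idxP K (phi s').
have h3 : cell_idx K (phi s') = tree_code w s K.+2 := s'E K.+2 (leqnn _).
rewrite h3 is_metric_sym // in h2.
have := is_metric_tri dM (phi' s) (dense_pt X (tree_code w s K.+2)) (phi s').
rewrite -/w in h1; lra.
Qed.

End Glue.

(** * The box distance and its triangle inequality *)

Section BoxMetric.
Variable R : realType.
Local Notation U := (@unit_itv R).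
Local Notation leb := (@lebesgue_measure R).
Implicit Types X Y Z : mmspace R.

Lemma dist4 X (x x' y y' : X) : `|mm_d x y - mm_d x' y'| <= mm_d x x' + mm_d y y'.
Proof.
have dM := mm_metric X; have tri := is_metric_tri dM; have sym := is_metric_sym dM.
have h1 := tri x x' y; have h2 := tri x' y' y; have h3 := tri x' x y'; have h4 := tri x y y'.
rewrite (sym y' y) in h2; rewrite (sym x' x) in h3.
by rewrite ler_norml; apply/andP; split; lra.
Qed.

Lemma lebI_ge (A B : set R) a b : measurable A -> measurable B -> A `<=` U -> B `<=` U ->
  ((1 - a)%:E <= leb A)%E -> ((1 - b)%:E <= leb B)%E ->
  ((1 - (a + b))%:E <= leb (A `&` B))%E.
Proof.
move=> mA mB AU BU la lb.
have mAB : measurable (A `&` B) by exact: measurableI.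
have mAD : measurable (A `\` B) by exact: measurableD.
have fin D : measurable D -> D `<=` U -> leb D \is a fin_num.
  by move=> mD DU; rewrite -(setIidr DU); apply: leb_unit_fin; rewrite setIidr.
have E1 : leb A = (leb (A `\` B) + leb (A `&` B))%E.
  rewrite -measureU //; last by rewrite setDE setIACA setICl setI0.
  by rewrite setUC setUIDK.
have E2 : (leb (A `\` B) + leb B <= 1)%E.
  rewrite -(lebesgue_unit R) -measureU //; last by rewrite setDE -setIA setICl setI0.
  apply: le_measure; rewrite ?inE; [exact: measurableU|exact: unit_itv_measurable|].
  by move=> s [[/AU]|/BU].
have fAB : leb (A `&` B) \is a fin_num by apply: fin => // s [/AU].
have fAD : leb (A `\` B) \is a fin_num by apply: fin => // s [/AU].
have fB : leb B \is a fin_num by apply: fin.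
move: la lb E2 fAB fAD fB; rewrite E1.
case: (leb (A `&` B)) => [p||] //; case: (leb (A `\` B)) => [q||] //; case: (leb B) => [r||] //.
rewrite -!EFinD !lee_fin => *; lra.
Qed.

Lemma box_admissible_glue X Y Z e1 e2 del : 0 < del ->
  box_admissible X Y e1 -> box_admissible Y Z e2 ->
  box_admissible X Z (e1 + e2 + del).
Proof.
move=> del0 [e10 [phi [psi [I1 [Pphi [Ppsi [mI1 [I1U [lI1 dI1]]]]]]]]].
move=> [e20 [psi' [chi [I2 [Ppsi' [Pchi [mI2 [I2U [lI2 dI2]]]]]]]]].
(* The errors add up to [16 * 2 ^- K]: 6 from [X], 6 from [Z], and 4 from comparing points in the
   same cell of [Y]. *)
have [K hK] := exp2V_small (divr_gt0 del0 (ltr0Sn R 15)).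
split; first by rewrite !addr_ge0 // ltW.
pose w1 := unit_tree (glue_code phi psi I1 K).
pose w2 := unit_tree (glue_code chi psi' I2 K).
have [phi' [Pphi' phi'P]] := glue_side K Pphi Ppsi mI1.
have [chi' [Pchi' chi'P]] := glue_side K Pchi Ppsi' mI2.
(* Both trees name the same cell of [Y] at every [s]; this matches the two parametrisations. *)
have w12 s : tree_code w1 s 0 = tree_code w2 s 0.
  by apply: code0_eq => i; rewrite /w1 /w2 !glue_tree1.
pose A1 := U `&` [set s | tree_code w1 s 1 = 0%N].
pose A2 := U `&` [set s | tree_code w2 s 1 = 0%N].
have m1 : measurable A1 := measurable_glue_set K Pphi Ppsi mI1.
have m2 : measurable A2 := measurable_glue_set K Pchi Ppsi' mI2.
have l1 : ((1 - e1)%:E <= leb A1)%E := glue_set_ge K Pphi Ppsi mI1 I1U lI1.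
have l2 : ((1 - e2)%:E <= leb A2)%E := glue_set_ge K Pchi Ppsi' mI2 I2U lI2.
have A1U : A1 `<=` U by move=> s [].
have A2U : A2 `<=` U by move=> s [].
exists phi', chi', (A1 `&` A2).
split; first exact: Pphi'.
split; first exact: Pchi'.
split; first exact: (measurableI _ _ m1 m2).
split; first by move=> s [/A1U].
split.
  apply: (@le_trans _ _ (1 - (e1 + e2))%:E).
    by rewrite lee_fin; lra.
  exact: (lebI_ge m1 m2 A1U A2U l1 l2).
move=> s t [s1 s2] [t1 t2].
have [sa Isa [sa1 sa2]] := phi'P s s1; have [ta Ita [ta1 ta2]] := phi'P t t1.
have [sb Isb [sb1 sb2]] := chi'P s s2; have [tb Itb [tb1 tb2]] := chi'P t t2.
have Dpsi u v : cell_idx K (u : Y) = cell_idx K v -> mm_d u v <= 2 * 2 ^- K.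
  move=> uv; have h1 := cell_idxP K u; have h2 := cell_idxP K v; rewrite -uv in h2.
  have := is_metric_tri (mm_metric Y) u (dense_pt Y (cell_idx K u)) v.
  rewrite (is_metric_sym (mm_metric Y) (dense_pt Y _) v); lra.
have Ys : mm_d (psi sa) (psi' sb) <= 2 * 2 ^- K by apply: Dpsi; rewrite sa2 sb2; exact: w12.
have Yt : mm_d (psi ta) (psi' tb) <= 2 * 2 ^- K by apply: Dpsi; rewrite ta2 tb2; exact: w12.
have h1 := dist4 (phi' s) (phi sa) (phi' t) (phi ta).
have h2 := dI1 _ _ Isa Ita.
have h3 := dist4 (psi sa) (psi' sb) (psi ta) (psi' tb).
have h4 := dI2 _ _ Isb Itb.
have h5 := dist4 (chi' s) (chi sb) (chi' t) (chi tb).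
move: h1 h2 h3 h4 h5; rewrite !ler_norml.
move=> /andP[? ?] /andP[? ?] /andP[? ?] /andP[? ?] /andP[? ?].
by apply/andP; split; lra.
Qed.

Lemma box_admissible_sym X Y e : box_admissible X Y e -> box_admissible Y X e.
Proof.
move=> [e0 [phi [psi [I [Pphi [Ppsi [mI [IU [lI dI]]]]]]]]]; split; first exact: e0.
exists psi, phi, I; split; first exact: Ppsi.
split; first exact: Pphi.
split; first exact: mI.
split; first exact: IU.
split; first exact: lI.
by move=> s t Is It; rewrite distrC; exact: dI.
Qed.

(** At error 1 the set [I0] may be empty, so any two parameters serve. *)
Lemma box_admissible1 X Y : box_admissible X Y 1.
Proof.
have [phi Pphi] := parameter_exists X; have [psi Ppsi] := parameter_exists Y.
split; first exact: ler01.
exists phi, psi, set0; split; first exact: Pphi.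
split; first exact: Ppsi.
split; first exact: measurable0.
split; first by move=> s [].
by split; [rewrite subrr measure0|].
Qed.

Lemma box_has_inf X Y : has_inf [set e | box_admissible X Y e].
Proof. by split; [exists 1; exact: box_admissible1|exists 0 => e []]. Qed.

Lemma box_le X Y e : box_admissible X Y e -> box X Y <= e.
Proof. by move=> h; apply: ge_inf => //; case: (box_has_inf X Y). Qed.

Lemma box_ge0 X Y : 0 <= box X Y.
Proof. by apply: lb_le_inf; [case: (box_has_inf X Y)|move=> e []]. Qed.

Lemma box_adherent X Y del : 0 < del -> exists2 e, box_admissible X Y e & e < box X Y + del.
Proof. by move=> del0; exact: inf_adherent (box_has_inf X Y). Qed.

Lemma box_sym X Y : box X Y = box Y X.
Proof.
by congr inf; apply/seteqP; split => e; exact: box_admissible_sym.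
Qed.

Lemma box_triangle X Y Z : box X Z <= box X Y + box Y Z.
Proof.
apply/ler_addgt0Pr => e e0; have e3 : 0 < e / 3 by rewrite divr_gt0.
have [e1 h1 l1] := box_adherent X Y e3; have [e2 h2 l2] := box_adherent Y Z e3.
have := box_le (box_admissible_glue e3 h1 h2); lra.
Qed.

(** * Optimal parameters *)

Lemma cell_idx_tail X j :
  (fun N => 1 - fine (mm_mu [set x : X | (cell_idx j x < N)%N])) @ \oo --> (0 : R).
Proof.
pose M := borel_measure_of (dense_pt X 0) (mm_prob X).
have M1 : M setT = 1%E := borel_measureT _ _.
have mL N : measurable
    ([set x : X | (cell_idx j x < N)%N] : set (borel_type (@mm_d R X) (dense_pt X 0))).
  exact: cell_idx_lt_borel.
have LT : \bigcup_N [set x : X | (cell_idx j x < N)%N] = setT.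
  by apply/seteqP; split => // x _; exists (cell_idx j x).+1 => /=.
rewrite -(subrr 1); apply: cvgB; first exact: cvg_cst.
have : M \o (fun N => [set x : X | (cell_idx j x < N)%N]) @ \oo --> M setT.
  rewrite -LT; apply: nondecreasing_cvg_mu => //; first by rewrite LT.
  by apply/nondecreasing_seqP => N; rewrite subsetEset => x /= /ltnW.
rewrite M1 => /fine_cvgP[_]; apply: cvg_trans; apply: near_eq_cvg; apply: nearW => N /=.
by rewrite borel_measureE //; exact: mL.
Qed.

(** Letter 0 is the membership bit; letters 2k + 1 and 2k + 2 are the cells of level k in [X] and in
    [Y]. *)
Definition pair_code X Y (phi : R -> X) (psi : R -> Y) I s k :=
  if k is k'.+1 then
    if odd k' then cell_idx k'./2 (psi s) else cell_idx k'./2 (phi s)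
  else bit I s.

Lemma measurable_pair_code X Y (phi : R -> X) (psi : R -> Y) I k i :
  parameter phi -> parameter psi -> measurable I ->
  measurable (U `&` [set s | pair_code phi psi I s k = i]).
Proof.
move=> Pphi Ppsi mI; case: k => [|k]; first exact: measurable_bit.
by rewrite /=; case: (odd k); exact: parameter_cell.
Qed.

(** Tail bound for [pair_code]: the marginals being fixed, it is the same for all parameters. The
    bit is 0 or 1, so its tail vanishes from 2 on. *)
Definition pair_tail X Y k N : R :=
  if k is k'.+1 then
    if odd k' then 1 - fine (mm_mu [set x : Y | (cell_idx k'./2 x < N)%N])
    else 1 - fine (mm_mu [set x : X | (cell_idx k'./2 x < N)%N])
  else (N < 2)%N%:R.

Lemma pair_tail_cvg X Y k : pair_tail X Y k @ \oo --> (0 : R).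
Proof.
case: k => [|k]; last first.
  case E : (odd k); [have := @cell_idx_tail Y k./2|have := @cell_idx_tail X k./2];
  by apply: cvg_trans; apply: near_eq_cvg; apply: nearW => N /=; rewrite E.
apply: cvg_near_cst; exists 2%N => // N /= N2; by rewrite ltnNge N2.
Qed.

Lemma box_optimal X Y : exists (phi : R -> X) (psi : R -> Y),
  [/\ parameter phi, parameter psi & forall s t : R,
   0 <= s < 1 - box X Y -> 0 <= t < 1 - box X Y ->
   `|mm_d (phi s) (phi t) - mm_d (psi s) (psi t)| <= box X Y].
Proof.
set eps := box X Y; have eps0 : 0 <= eps := box_ge0 X Y.
pose data := (R * ((R -> X) * ((R -> Y) * set R)))%type.
have /choice[D DP] n : exists D : data,
    [/\ parameter D.2.1, parameter D.2.2.1, measurable D.2.2.2 /\ D.2.2.2 `<=` U,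
       ((1 - D.1)%:E <= leb D.2.2.2)%E /\ D.1 < eps + n.+1%:R^-1 &
       forall s t, D.2.2.2 s -> D.2.2.2 t ->
         `|mm_d (D.2.1 s) (D.2.1 t) - mm_d (D.2.2.1 s) (D.2.2.1 t)| <= D.1].
  have [|e [e0 [phi [psi [I [? [? [? [? [? dI]]]]]]]]] le] := @box_adherent X Y n.+1%:R^-1.
    by rewrite invr_gt0.
  by exists (e, (phi, (psi, I))).
pose phi_ n := (D n).2.1; pose psi_ n := (D n).2.2.1; pose I_ n := (D n).2.2.2.
pose C n := pair_code (phi_ n) (psi_ n) (I_ n).
have mC n k i : measurable (U `&` [set s | C n s k = i]).
  by have [? ? [? _] _ _] := DP n; exact: measurable_pair_code.
(* The ultrafilter refines convergence to infinity, so the excess of the approximants over [eps]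
   vanishes along it. *)
have [V [VU ooV]] := @ultraFilterLemma nat \oo _.
have VP : ProperFilter V by exact: ultra_proper.
pose w_ n := unit_tree (C n).
have w_T n : tree (w_ n) := unit_treeP (mC n).
have tau0 k : pair_tail X Y k @ \oo --> (0 : R).
  exact: pair_tail_cvg.
have w_tau n p N : w_ n p - \sum_(i < N) w_ n (nat_of_ord i :: p) <= pair_tail X Y (size p) N.
  have [[_ lphi] [_ lpsi] _ _ _] := DP n.
  apply: le_trans (unit_tree_tail (mC n) p N) _; rewrite /C /pair_code.
  case: (size p) => [|k] /=; last first.
    by case: (odd k); rewrite -(lphi, lpsi) //; exact: cell_idx_lt_borel.
  case: ltnP => N2 /=.
    by rewrite lerBlDr lerDl; exact/fine_ge0/measure_ge0.
  rewrite (_ : [set s | _] = setT) ?setIT ?lebesgue_unit ?subrr //.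
  apply/seteqP; split => // s _ /=; rewrite /bit; case: asboolP => _ //.
  exact: leq_trans N2.
pose w := ultra_tree V w_.
have wT : tree w := ultra_treeP VU w_T tau0 w_tau.
(* Both words are realised at one index [n], since the distance estimate compares two points under
   the same pair of parameters. *)
have real p q M : 0 < w p -> 0 < w q -> exists n s t, [/\ (M <= n)%N, U s, U t,
    prefix_of (C n s) (size p) = p & prefix_of (C n t) (size q) = q].
  move=> /(ultra_tree_gt0 VU w_T) hp /(ultra_tree_gt0 VU w_T) hq.
  have hM : V [set n | (M <= n)%N] by apply: ooV; exists M.
  have [n [[/= np nq] Mn]] := filter_ex (filterI (filterI hp hq) hM).
  have [s [us sp]] := unit_tree_ex np; have [t [ut tq]] := unit_tree_ex nq.
  by exists n, s, t.
have real1 s k : U s -> exists n s', U s' /\ forall j, (j < k)%N -> C n s' j = tree_code w s j.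
  move=> us; have h := node_gt0 wT k us.
  have [n [s' [t' [_ us' _ + _]]]] := real _ _ 0%N h h.
  rewrite size_prefix_of => /prefix_of_inj s'E.
  by exists n, s'; split; [exact: us'|exact: s'E].
have [|||phi [Pphi phiP]] := @code_parameter R X (fun s k => tree_code w s (k.*2).+1).
- by move=> k i; exact: measurable_code.
- move=> k i; have bI := @cell_idx_borel R X k i.
  suff h : marginal_le w (k.*2).+1 i (fine (mm_mu [set x : X | cell_idx k x = i])).
    have [[mphi lphi] _ _ _ _] := DP 0%N.
    have /le_trans := code_marginal wT h; apply; rewrite -(lphi _ bI) fineK //.
    by apply: leb_unit_fin; exact: mphi.
  apply: (ultra_tree_marginal VU w_T) => n.
  have [[mphi lphi] _ _ _ _] := DP n.
  have := @unit_tree_marginal _ _ (mC n) (k.*2).+1 i.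
  by rewrite -(lphi _ bI) /C /= odd_double doubleK.
- move=> s k us; have [n [s' [us' h]]] := real1 s (k.*2).+2 us.
  exists (phi_ n s') => j jk; rewrite -h ?ltnS ?leq_double //.
  by rewrite /C /= odd_double doubleK.
have [|||psi [Ppsi psiP]] := @code_parameter R Y (fun s k => tree_code w s (k.*2).+2).
- by move=> k i; exact: measurable_code.
- move=> k i; have bI := @cell_idx_borel R Y k i.
  suff h : marginal_le w (k.*2).+2 i (fine (mm_mu [set x : Y | cell_idx k x = i])).
    have [_ [mpsi lpsi] _ _ _] := DP 0%N.
    have /le_trans := code_marginal wT h; apply; rewrite -(lpsi _ bI) fineK //.
    by apply: leb_unit_fin; exact: mpsi.
  apply: (ultra_tree_marginal VU w_T) => n.
  have [_ [mpsi lpsi] _ _ _] := DP n.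
  have := @unit_tree_marginal _ _ (mC n) (k.*2).+2 i.
  by rewrite -(lpsi _ bI) /C /= odd_double /= uphalf_double.
- move=> s k us; have [n [s' [us' h]]] := real1 s (k.*2).+3 us.
  exists (psi_ n s') => j jk; rewrite -h ?ltnS ?leq_double //.
  by rewrite /C /= odd_double /= uphalf_double.
exists phi, psi; split=> //.
(* In the approximant [n] this weight is the measure of [I_ n], at least [1 - eps - n.+1%:R^-1]. *)
have w0 : 1 - eps <= w [:: 0%N].
  apply/ler_addgt0Pr => e e0; rewrite -lerBlDr.
  apply: (@cvgr_to_ge _ V VP _ _ _ _ (ultra_tree_cvg VU w_T (p := [:: 0%N]))).
  have [M /= hM] := ltr_add_invr e0; rewrite add0r in hM.
  have : V [set n | (M <= n)%N] by apply: ooV; exists M.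
  apply: filterS => n /= Mn; rewrite /w_ unit_tree1.
  have [_ _ [mI IU] [lI le] _] := DP n.
  have -> : U `&` [set s | C n s 0 = 0%N] = I_ n.
    rewrite /C /= /bit; apply/seteqP; split => s /=; first by case: asboolP => // ? [].
    by move=> Is; split; [exact: IU|rewrite asboolT].
  rewrite -lee_fin fineK; last by rewrite /I_ -(setIidr IU); apply: leb_unit_fin; rewrite setIidr.
  apply: le_trans lI; rewrite lee_fin.
  have h2 : n.+1%:R^-1 <= M.+1%:R^-1 :> R by rewrite lef_pV2 ?posrE // ler_nat.
  move: hM le h2; move: (M.+1%:R^-1 : R) (n.+1%:R^-1 : R) => a b; lra.
(* Bit 0 owns the leftmost interval, of length at least [1 - eps]; this makes the good set an
   initial interval. *)
have code0 s : 0 <= s < 1 - eps -> U s /\ tree_code w s 0 = 0%N.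
  move=> /andP[s0 s1]; split; first by rewrite /unit_itv /= s0 /=; lra.
  have : cell w [:: 0%N] s by rewrite /cell /= big_ord0 addr0 add0r s0 /=; lra.
  by move=> /(cell_node wT) /= [].
move=> s t /code0[us s0] /code0[ut t0]; apply/ler_addgt0Pr => e e0.
(* Four approximations at [3 * 2 ^- k] each take at most half of [e]; the excess of the approximant
   over [eps] takes the other half. *)
have [k hk] := exp2V_small (divr_gt0 e0 (ltr0Sn R 23)).
have [M hM] := ltr_add_invr (divr_gt0 e0 (ltr0Sn R 1)); rewrite add0r in hM.
(* A prefix of length 2k + 3 contains the bit and the cells of level k of both spaces. *)
have [n [s' [t' []]]] := real _ _ M (node_gt0 wT k.*2.+3 us) (node_gt0 wT k.*2.+3 ut).
rewrite !size_prefix_of => Mn us' ut' /prefix_of_inj s'E /prefix_of_inj t'E.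
have [_ _ [mI IU] [_ le] dI] := DP n.
have I0 u v : tree_code w u 0 = 0%N ->
    (forall j, (j < (k.*2).+3)%N -> C n v j = tree_code w u j) -> I_ n v.
  by move=> u0 /(_ 0%N isT); rewrite u0 /C /= /bit; case: asboolP.
have HX u v : U u -> (forall j, (j < (k.*2).+3)%N -> C n v j = tree_code w u j) ->
    mm_d (phi u) (phi_ n v) <= 3 * 2 ^- k.
  move=> uu /(_ (k.*2).+1); rewrite /C /= odd_double doubleK => h.
  have h1 := phiP u k uu; have h2 := cell_idxP k (phi_ n v).
  rewrite h ?ltnS // (is_metric_sym (mm_metric X)) in h2.
  have := is_metric_tri (mm_metric X) (phi u)
    (dense_pt X (tree_code w u (k.*2).+1)) (phi_ n v); lra.
have HY u v : U u -> (forall j, (j < (k.*2).+3)%N -> C n v j = tree_code w u j) ->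
    mm_d (psi u) (psi_ n v) <= 3 * 2 ^- k.
  move=> uu /(_ (k.*2).+2); rewrite /C /= odd_double /= uphalf_double => h.
  have h1 := psiP u k uu; have h2 := cell_idxP k (psi_ n v).
  rewrite h ?ltnS // (is_metric_sym (mm_metric Y)) in h2.
  have := is_metric_tri (mm_metric Y) (psi u)
    (dense_pt Y (tree_code w u (k.*2).+2)) (psi_ n v); lra.
have h1 := dist4 (phi s) (phi_ n s') (phi t) (phi_ n t').
have h2 := dI _ _ (I0 _ _ s0 s'E) (I0 _ _ t0 t'E).
have h3 := dist4 (psi s) (psi_ n s') (psi t) (psi_ n t').
have h4 := HX _ _ us s'E; have h5 := HX _ _ ut t'E.
have h6 := HY _ _ us s'E; have h7 := HY _ _ ut t'E.
have h8 : n.+1%:R^-1 <= M.+1%:R^-1 :> R by rewrite lef_pV2 ?posrE // ler_nat.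
move: hM le h8 h1 h2 h3; rewrite -/(phi_ n) -/(psi_ n).
move: (M.+1%:R^-1 : R) (n.+1%:R^-1 : R) => a b hM le h8; rewrite !ler_norml.
move=> /andP[? ?] /andP[? ?] /andP[? ?].
by apply/andP; split; lra.
Qed.

End BoxMetric.

(** * Complete separable spaces of functions *)

Section FunClosure.
Variables (R : realType) (Q A : Type) (m : A -> Q -> R) (a : nat -> A) (q0 : Q).
Hypothesis m_bounded : forall x y, exists M : R, forall q, `|m x q - m y q| <= M.
Hypothesis a_dense : forall x (e : R), 0 < e ->
  exists n, forall q, `|m x q - m (a n) q| <= e.

(** The uniform closure of the countable family [m (a n)]. The functions may be unbounded;
    boundedness of their differences makes the sup metric finite. *)
Definition in_closure (h : Q -> R) := forall e : R, 0 < e ->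
  exists n, forall q, `|h q - m (a n) q| <= e.

Definition fclosure := {h : Q -> R | in_closure h}.

Definition femb (x : A) : fclosure := exist _ (m x) (a_dense x).

Definition fdist (f g : fclosure) : R :=
  sup [set `|sval f q - sval g q| | q in setT].

Lemma fdist_has_sup (f g : fclosure) : has_sup [set `|sval f q - sval g q| | q in setT].
Proof.
split; first by exists (`|sval f q0 - sval g q0|), q0.
have [n hn] := svalP f 1 ltr01; have [k hk] := svalP g 1 ltr01.
have [M hM] := m_bounded (a n) (a k).
exists (1 + M + 1) => _ [q _ <-].
move: (hn q) (hk q) (hM q); rewrite !ler_norml.
by move=> /andP[? ?] /andP[? ?] /andP[? ?]; apply/andP; split; lra.
Qed.

Lemma fdist_ub (f g : fclosure) q : `|sval f q - sval g q| <= fdist f g.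
Proof. by apply: ub_le_sup; [case: (fdist_has_sup f g)|exists q]. Qed.

Lemma fdist_le (f g : fclosure) (M : R) : (forall q, `|sval f q - sval g q| <= M) -> fdist f g <= M.
Proof.
by move=> h; apply: ge_sup; [case: (fdist_has_sup f g)|move=> _ [q _ <-]].
Qed.

Lemma fdist_metric : is_metric fdist.
Proof.
split=> [f g|]; [split=> [fg0|->]|split=> [f g|f g h]].
- suff : sval f = sval g.
    case: f g {fg0} => [f hf] [g hg] /= fg; subst g; congr exist; exact: Prop_irrelevance.
  apply/funext => q; apply/eqP; rewrite -subr_eq0 -normr_le0 -fg0; exact: fdist_ub.
- apply/eqP; rewrite eq_le; apply/andP; split.
    by apply: fdist_le => q; rewrite subrr normr0.
  by apply: le_trans (fdist_ub g g q0); exact: normr_ge0.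
- by apply/eqP; rewrite eq_le !fdist_le // => q; rewrite distrC; exact: fdist_ub.
- apply: fdist_le => q; apply: le_trans (ler_distD (sval g q) _ _) _.
  by apply: lerD; exact: fdist_ub.
Qed.

Lemma fdist_separable : dseparable fdist.
Proof.
exists (fun n => femb (a n)) => f e e0.
have [n hn] := svalP f (e / 2) (divr_gt0 e0 (ltr0Sn R 1)); exists n.
have : fdist f (femb (a n)) <= e / 2 by exact: fdist_le.
lra.
Qed.

(** The Cauchy condition makes pointwise limits uniform, and uniform limits stay in the closure. *)
Lemma fdist_complete : dcomplete fdist.
Proof.
move=> u uC.
have cvu q : cvg ((fun n => sval (u n) q) @ \oo).
  apply/cauchy_cvgP/cauchy_exP => e e0; have [N hN] := uC e e0.
  exists (sval (u N) q); exists N => // n /= Nn.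
  by apply: le_lt_trans (fdist_ub _ _ _) (hN _ _ _ Nn).
pose h q : R := lim ((fun n => sval (u n) q) @ \oo).
have uh (e : R) : 0 < e -> exists N, forall n q, (N <= n)%N -> `|sval (u n) q - h q| <= e.
  move=> e0; have [N hN] := uC e e0; exists N => n q Nn.
  have c : (fun k => `|sval (u n) q - sval (u k) q|) @ \oo --> `|sval (u n) q - h q|.
    by apply: cvg_norm; apply: cvgB; [exact: cvg_cst|exact: cvu].
  apply: (cvgr_to_le c); exists N => // k /= Nk.
  by apply/ltW/(le_lt_trans (fdist_ub _ _ _)); exact: hN.
have hh : in_closure h.
  move=> e e0; have e2 : 0 < e / 2 by rewrite divr_gt0.
  have [N hN] := uh _ e2; have [n hn] := svalP (u N) _ e2; exists n => q.
  move: (hN N q (leqnn N)) (hn q); rewrite !ler_norml.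
  by move=> /andP[? ?] /andP[? ?]; apply/andP; split; lra.
exists (exist _ h hh) => e e0; have [N hN] := uh (e / 2) (divr_gt0 e0 (ltr0Sn R 1)).
exists N => n Nn; have : fdist (u n) (exist _ h hh) <= e / 2.
  by apply: fdist_le => q; exact: hN.
lra.
Qed.

End FunClosure.

(* A metric on the disjoint union of [X] and [Y] with [phi u] and [psi u] at distance
   [eps / 2], and the associated Kuratowski embeddings. *)
Section Kuratowski.
Variables (R : realType) (X Y : mmspace R) (phi : R -> X) (psi : R -> Y).
Variables (eps : R) (S : set R) (u0 : R).
Hypotheses (eps0 : 0 <= eps) (Su0 : S u0).
Hypothesis distS : forall u v, S u -> S v ->
  `|mm_d (phi u) (phi v) - mm_d (psi u) (psi v)| <= eps.

Let dX := is_metric_tri (mm_metric X).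
Let dY := is_metric_tri (mm_metric Y).
Let sX := is_metric_sym (mm_metric X).
Let sY := is_metric_sym (mm_metric Y).
Let pX := is_metric_ge0 (mm_metric X).
Let pY := is_metric_ge0 (mm_metric Y).
Let zX := is_metric_xx (mm_metric X).
Let zY := is_metric_xx (mm_metric Y).

Definition cross_dist (x : X) (y : Y) : R :=
  inf [set mm_d x (phi u) + eps / 2 + mm_d (psi u) y | u in S].

Lemma cross_dist_le x y u : S u ->
  cross_dist x y <= mm_d x (phi u) + eps / 2 + mm_d (psi u) y.
Proof.
move=> Su; apply: ge_inf; last by exists u.
by exists 0 => _ [v _ <-]; rewrite !addr_ge0 // divr_ge0.
Qed.

Lemma cross_dist_ge x y c :
  (forall u, S u -> c <= mm_d x (phi u) + eps / 2 + mm_d (psi u) y) ->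
  c <= cross_dist x y.
Proof.
move=> h; apply: lb_le_inf; last by move=> _ [u Su <-]; exact: h.
by eexists; exists u0.
Qed.

Lemma cross_dist_lipl x x' y : cross_dist x y <= mm_d x x' + cross_dist x' y.
Proof.
rewrite -lerBlDl; apply: cross_dist_ge => u Su.
have := cross_dist_le x y Su; have := dX x x' (phi u); lra.
Qed.

Lemma cross_dist_lipr x y y' : cross_dist x y <= cross_dist x y' + mm_d y' y.
Proof.
rewrite -lerBlDr; apply: cross_dist_ge => u Su.
have := cross_dist_le x y Su; have := dY (psi u) y' y; lra.
Qed.

(** The pair [u] itself gives the upper bound. A route through another pair [v] gains at most [eps]
    by distortion and pays half of it for crossing. *)
Lemma cross_dist_phi u y : S u ->
  `|cross_dist (phi u) y - mm_d (psi u) y| <= eps / 2.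
Proof.
move=> Su; rewrite ler_norml; apply/andP; split; last first.
  have := cross_dist_le (phi u) y Su; rewrite zX; lra.
rewrite lerBrDr; apply: cross_dist_ge => v Sv.
have := distS Su Sv; rewrite ler_norml => /andP[_ h].
have := distS Su Sv; rewrite ler_norml => /andP[h' _].
have := dY (psi u) (psi v) y; lra.
Qed.

Lemma cross_dist_psi x u : S u ->
  `|mm_d (phi u) x - cross_dist x (psi u)| <= eps / 2.
Proof.
move=> Su; rewrite distrC ler_norml; apply/andP; split; last first.
  have := cross_dist_le x (psi u) Su; rewrite zY (sX x); lra.
rewrite lerBrDr; apply: cross_dist_ge => v Sv.
have := distS Su Sv; rewrite ler_norml => /andP[_ h].
have := dX (phi u) (phi v) x; rewrite (sX (phi v)) (sY (psi v)); lra.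
Qed.

Definition kurX (x : X) (q : X + Y) : R :=
  match q with inl x' => mm_d x x' | inr y' => cross_dist x y' end.

Definition kurY (y : Y) (q : X + Y) : R :=
  match q with inl x' => cross_dist x' y | inr y' => mm_d y y' end.

Lemma kurX_lip x x' q : `|kurX x q - kurX x' q| <= mm_d x x'.
Proof.
rewrite ler_norml; case: q => [z|y] /=.
  have := dX x x' z; have := dX x' x z; rewrite (sX x' x) => ? ?; apply/andP; split; lra.
have := cross_dist_lipl x x' y; have := cross_dist_lipl x' x y; rewrite (sX x' x) => ? ?.
by apply/andP; split; lra.
Qed.

Lemma kurY_lip y y' q : `|kurY y q - kurY y' q| <= mm_d y y'.
Proof.
rewrite ler_norml; case: q => [x|z] /=.
  have := cross_dist_lipr x y y'; have := cross_dist_lipr x y' y; rewrite (sY y' y) => ? ?.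
  by apply/andP; split; lra.
have := dY y y' z; have := dY y' y z; rewrite (sY y' y) => ? ?; apply/andP; split; lra.
Qed.

(** One coordinate attains the Lipschitz bound, so the embedding is isometric for the sup metric. *)
Lemma kurX_iso x x' : `|kurX x (inl x') - kurX x' (inl x')| = mm_d x x'.
Proof. by rewrite /= zX subr0 ger0_norm. Qed.

Lemma kurY_iso y y' : `|kurY y (inr y') - kurY y' (inr y')| = mm_d y y'.
Proof. by rewrite /= zY subr0 ger0_norm. Qed.

Lemma kur_close u q : S u -> `|kurX (phi u) q - kurY (psi u) q| <= eps / 2.
Proof.
by move=> Su; case: q => [x|y] /=; [exact: cross_dist_psi|exact: cross_dist_phi].
Qed.

End Kuratowski.

(** The sup metric as a relation, so that [X] and [Y] with their own distances can serve as the end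
    spaces. *)
Definition sup_dist (R : realType) (Q : Type) (f g : Q -> R) (D : R) :=
  (forall q, `|f q - g q| <= D) /\
  (forall M : R, (forall q, `|f q - g q| <= M) -> D <= M).

(** * The interpolating spaces *)

Section Interpolation.
Variables (R : realType) (X Y : mmspace R) (phi : R -> X) (psi : R -> Y) (eps : R).
Local Notation U := (@unit_itv R).
Local Notation leb := (@lebesgue_measure R).
Hypotheses (Pphi : parameter phi) (Ppsi : parameter psi).
Hypothesis eps01 : 0 <= eps <= 1.
Hypothesis dist_eps : forall s t : R, 0 <= s < 1 - eps -> 0 <= t < 1 - eps ->
   `|mm_d (phi s) (phi t) - mm_d (psi s) (psi t)| <= eps.

Let eps0 : 0 <= eps. Proof. by case/andP: eps01. Qed.
Let eps1 : eps <= 1. Proof. by case/andP: eps01. Qed.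

(* [0] is added so that the set is nonempty when [eps = 1]. *)
Definition matched : set R := [set u | u = 0 \/ 0 <= u < 1 - eps].

Let m0 : matched 0. Proof. by left. Qed.

Let dist_matched u v : matched u -> matched v ->
  `|mm_d (phi u) (phi v) - mm_d (psi u) (psi v)| <= eps.
Proof.
(* Either 0 lies in the initial interval, or [matched] reduces to the single point 0. *)
have [e1|e1] := ltP 0 (1 - eps).
  by move=> [->|hu] [->|hv]; apply: dist_eps; rewrite ?lexx.
have nul w : matched w -> w = 0.
  by move=> [//|/andP[h1 h2]]; exfalso; lra.
move=> /nul-> /nul->.
by rewrite (is_metric_xx (mm_metric X)) (is_metric_xx (mm_metric Y)) subrr normr0.
Qed.

Let kX := kurX phi psi eps matched.
Let kY := kurY phi psi eps matched.

(** [None]: matched, moving linearly; [Some true]: already jumped to [Y]; [Some false]: still in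
    [X]. By time [t] a length [t * eps] has jumped. *)
Definition weight_case (t u : R) : option bool :=
  if u < 1 - eps then None else if u < 1 - eps + t * eps then Some true else Some false.

Definition weight (t : R) (b : option bool) : R :=
  match b with None => t | Some true => 1 | Some false => 0 end.

Lemma weight01 (t : R) b : 0 <= t <= 1 -> 0 <= weight t b <= 1.
Proof. by move=> t01; case: b => [[]|] //=; rewrite ?lexx ?ler01. Qed.

Definition mix (t : R) (a : option bool * X * Y) (q : X + Y) : R :=
  (1 - weight t a.1.1) * kX a.1.2 q + weight t a.1.1 * kY a.2 q.

Definition profile t u := mix t (weight_case t u, phi u, psi u).

Lemma mix_lip (t : R) b x y x' y' q : 0 <= t <= 1 ->
  `|mix t (b, x, y) q - mix t (b, x', y') q| <= mm_d x x' + mm_d y y'.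
Proof.
move=> /(weight01 b) /andP[w0 w1]; rewrite /mix /=.
have hX := kurX_lip phi psi eps0 m0 x x' q; have hY := kurY_lip phi psi eps0 m0 y y' q.
rewrite -/kX -/kY in hX hY *.
set w := weight t b in w0 w1 *.
have -> : (1 - w) * kX x q + w * kY y q - ((1 - w) * kX x' q + w * kY y' q) =
  (1 - w) * (kX x q - kX x' q) + w * (kY y q - kY y' q) by ring.
apply: le_trans (ler_normD _ _) _; rewrite !normrM (ger0_norm w0) ger0_norm ?subr_ge0 //.
apply: lerD.
  by apply: le_trans hX; rewrite ler_piMl // gerBl.
by apply: le_trans hY; rewrite ler_piMl.
Qed.

(** Each [mix t a] is at finite sup distance from one fixed function, so any two are at finite
    distance. *)
Lemma mix_bound (t : R) b x y q : 0 <= t <= 1 ->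
  `|mix t (b, x, y) q - kX (phi 0) q| <=
  mm_d x (phi 0) + (mm_d y (psi 0) + eps / 2).
Proof.
move=> /(weight01 b) /andP[w0 w1]; rewrite /mix /=.
have hX := kurX_lip phi psi eps0 m0 x (phi 0) q.
have hY := kurY_lip phi psi eps0 m0 y (psi 0) q.
have hXY := kur_close eps0 m0 dist_matched q m0.
rewrite -/kX -/kY in hX hY hXY *.
set w := weight t b in w0 w1 *.
have -> : (1 - w) * kX x q + w * kY y q - kX (phi 0) q =
  (1 - w) * (kX x q - kX (phi 0) q) + w * (kY y q - kX (phi 0) q) by ring.
apply: le_trans (ler_normD _ _) _; rewrite !normrM (ger0_norm w0) ger0_norm ?subr_ge0 //.
apply: lerD.
  by apply: le_trans hX; rewrite ler_piMl // gerBl.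
apply: (@le_trans _ _ `|kY y q - kX (phi 0) q|); first by rewrite ler_piMl.
apply: le_trans (ler_distD (kY (psi 0) q) _ _) _; apply: lerD => //.
by rewrite distrC.
Qed.

Lemma measurable_weight_case t b : measurable (U `&` [set u | weight_case t u = b]).
Proof.
have mU := @unit_itv_measurable R.
have mlt c : measurable [set u : R | u < c].
  by rewrite (_ : [set u | _] = [set` `]-oo, c[]).
apply: measurableI => //; rewrite /weight_case.
case: b => [[]|].
- rewrite (_ : [set u | _] = [set u | u < 1 - eps + t * eps] `\` [set u | u < 1 - eps]).
    exact: measurableD.
  apply/seteqP; split => u /=.
    by case: ifP => // h; case: ifP => // h' _; split=> //; rewrite h.
  by move=> [h' /negP/negbTE h]; rewrite h h'.
- rewrite (_ : [set u | _] = ~` [set u | u < 1 - eps + t * eps] `\` [set u | u < 1 - eps]).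
    by apply: measurableD => //; exact: measurableC.
  apply/seteqP; split => u /=.
    by case: ifP => // h; case: ifP => // h' _; split=> //; rewrite ?h ?h'.
  by move=> [/negP/negbTE h' /negP/negbTE h]; rewrite h h'.
- rewrite (_ : [set u | _] = [set u | u < 1 - eps]) //.
  by apply/seteqP; split => u /=; case: ifP => //; case: ifP.
Qed.

Lemma interpolation_space (t : R) : 0 <= t <= 1 ->
  exists (Z : mmspace R) (p : R -> Z), parameter p /\
    forall u v, sup_dist (profile t u) (profile t v) (mm_d (p u) (p v)).
Proof.
move=> t01.
pose a n : option bool * X * Y :=
  if unpickle n is Some (b, i, j) then (b, dense_pt X i, dense_pt Y j)
  else (None, dense_pt X 0, dense_pt Y 0).
have aE b i j : a (pickle (b, i, j)) = (b, dense_pt X i, dense_pt Y j).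
  by rewrite /a pickleK.
have bd x y : exists M : R, forall q, `|mix t x q - mix t y q| <= M.
  case: x y => [[b x] y] [[b' x'] y']; eexists => q.
  apply: le_trans (ler_distD (kX (phi 0) q) _ _) _.
  apply: lerD; first exact: mix_bound.
  rewrite distrC; exact: mix_bound.
have near k (b : option bool) x y q : `|mix t (b, x, y) q -
    mix t (b, dense_pt X (cell_idx k x), dense_pt Y (cell_idx k y)) q| <= 2 * 2 ^- k.
  apply: le_trans (mix_lip _ _ _ _ _ _ t01) _.
  have := cell_idxP k x; have := cell_idxP k y; lra.
have dn x (e : R) : 0 < e -> exists n, forall q, `|mix t x q - mix t (a n) q| <= e.
  case: x => [[b x] y] e0; have [k hk] := exp2V_small (divr_gt0 e0 (ltr0Sn R 1)).
  exists (pickle (b, cell_idx k x, cell_idx k y)) => q; rewrite aE.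
  have := near k b x y q; lra.
pose q0 : X + Y := inl (phi 0).
pose p u := femb dn (weight_case t u, phi u, psi u).
have dM := fdist_metric a q0 bd.
have mp : forall B, dborel (@fdist _ _ _ (mix t) a) B -> measurable (U `&` p @^-1` B).
  apply: (approx_measurable dM (I := (option bool * nat * nat)%type)) => e e0.
  have [k hk] := exp2V_small (divr_gt0 e0 (ltr0Sn R 1)).
  exists (fun u => (weight_case t u, cell_idx k (phi u), cell_idx k (psi u))).
  exists (fun bij => femb dn (bij.1.1, dense_pt X bij.1.2, dense_pt Y bij.2)).
  split=> [[[b i] j]|u _].
    rewrite (_ : U `&` _ = (U `&` [set u | weight_case t u = b]) `&`
      (U `&` [set u | cell_idx k (phi u) = i]) `&` (U `&` [set u | cell_idx k (psi u) = j])).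
      apply: measurableI; last exact: parameter_cell.
      by apply: measurableI; [exact: measurable_weight_case|exact: parameter_cell].
    apply/seteqP; split => u /=; first by case=> uu [-> -> ->].
    by case=> [[[uu ->] [_ ->]] [_ ->]].
  apply: (@le_lt_trans _ _ (2 * 2 ^- k)); last by lra.
  by apply: (fdist_le q0 bd) => q; exact: near.
(* The measure is the push-forward of Lebesgue measure by [p], so [p] is a parameter by
   construction. *)
pose Z := MMSpace dM (fdist_complete q0 bd) (fdist_separable q0 bd dn)
  (law_borel_probability mp).
exists Z, p; split; first by [].
move=> u v; split=> [q|M hM].
  exact: (fdist_ub q0 bd (p u) (p v)).
exact: (fdist_le q0 bd (f := p u) (g := p v)).
Qed.

(** A matched point covers the fraction [t - s] of a segment of sup length at most [eps / 2]; other
    points that do not jump stay put. *)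
Lemma weight_case_move (s t u : R) : 0 <= s -> s <= t -> t <= 1 -> U u ->
  ~ (1 - eps + s * eps <= u < 1 - eps + t * eps) ->
  forall q, `|profile t u q - profile s u q| <= (t - s) * (eps / 2).
Proof.
move=> s0 st t1 /andP[u0 u1] nu q; rewrite /profile /mix /weight_case /=.
have se0 : s * eps <= t * eps by rewrite ler_wpM2r.
have ts0 : 0 <= (t - s) * (eps / 2) by rewrite mulr_ge0 ?subr_ge0 // divr_ge0.
case: ifP => [h|/negbT]; last rewrite -leNgt => h.
  have mu : matched u by right; rewrite u0.
  have := kur_close eps0 m0 dist_matched q mu; rewrite -/kX -/kY /= => hk.
  rewrite (_ : _ - _ = (s - t) * (kX (phi u) q - kY (psi u) q)); last by ring.
  rewrite normrM [`|s - t|]distrC (@ger0_norm _ (t - s)) ?subr_ge0 //.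
  by apply: ler_wpM2l => //; rewrite subr_ge0.
case: ltP => ht; case: ltP => hs /=; rewrite ?subrr ?normr0 //.
  by exfalso; apply: nu; rewrite hs ht.
by exfalso; lra.
Qed.

(** The points that jump between [s] and [t] fill an interval of length [(t - s) * eps] and are
    discarded; for the others both ends of a distance move by at most half that amount. *)
Lemma interpolation_admissible (Z Z' : mmspace R) (p : R -> Z) (p' : R -> Z') (s t : R) :
  0 <= s -> s <= t -> t <= 1 -> parameter p -> parameter p' ->
  (forall u v, U u -> U v -> sup_dist (profile s u) (profile s v) (mm_d (p u) (p v))) ->
  (forall u v, U u -> U v -> sup_dist (profile t u) (profile t v) (mm_d (p' u) (p' v))) ->
  box_admissible Z Z' ((t - s) * eps).
Proof.
move=> s0 st t1 Pp Pp' Dp Dp'.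
have se0 : 0 <= s * eps by rewrite mulr_ge0.
have st_eps : s * eps <= t * eps by rewrite ler_wpM2r.
have te1 : t * eps <= eps by rewrite ler_piMl.
have e0 := eps0; have e1 := eps1.
split; first by rewrite mulr_ge0 ?subr_ge0.
pose A := [set` `[0, 1 - eps + s * eps[] : set R.
pose B := [set` `[1 - eps + t * eps, 1[] : set R.
have mA : measurable A by exact: measurable_itv.
have mB : measurable B by exact: measurable_itv.
have IE u : (A `|` B) u -> U u /\ ~ (1 - eps + s * eps <= u < 1 - eps + t * eps).
  rewrite /A /B /unit_itv /= !in_itv /=.
  move=> [/andP[h1 h2]|/andP[h1 h2]]; split.
  - by apply/andP; split; lra.
  - by move=> /andP[h3 h4]; lra.
  - apply/andP; split=> //; apply: le_trans h1.
    by rewrite addr_ge0 ?subr_ge0 // mulr_ge0 // (le_trans s0).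
  - by move=> /andP[h3 h4]; lra.
exists p, p', (A `|` B); split; first exact: Pp.
split; first exact: Pp'.
split; first exact: measurableU.
split; first by move=> u /IE[].
split.
  have -> : leb (A `|` B) = (leb A + leb B)%E.
    rewrite measureU //; apply/seteqP; split => // u.
    by rewrite /A /B /= !in_itv /= => -[/andP[? ?] /andP[? ?]]; lra.
  have lA : leb A = (1 - eps + s * eps)%:E.
    rewrite /A lebesgue_measure_itv /= lte_fin; case: ltP => h; first by rewrite -EFinB subr0.
    by congr EFin; lra.
  have lB : leb B = (1 - (1 - eps + t * eps))%:E.
    rewrite /B lebesgue_measure_itv /= lte_fin; case: ltP => h; first by rewrite -EFinB.
    by congr EFin; lra.
  rewrite lA lB -EFinD lee_fin.
  by rewrite mulrBl; lra.
move=> u v /IE[uu nu] /IE[uv nv].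
have hu := weight_case_move s0 st t1 uu nu; have hv := weight_case_move s0 st t1 uv nv.
have [D1 D2] := Dp u v uu uv; have [D1' D2'] := Dp' u v uu uv.
set c := (t - s) * (eps / 2) in hu hv.
have cE : (t - s) * eps = c + c by rewrite /c; field.
rewrite cE ler_norml; apply/andP; split.
  suff : mm_d (p' u) (p' v) <= mm_d (p u) (p v) + (c + c) by lra.
  apply: D2' => q; move: (hu q) (hv q) (D1 q); rewrite !ler_norml.
  by move=> /andP[? ?] /andP[? ?] /andP[? ?]; apply/andP; split; lra.
suff : mm_d (p u) (p v) <= mm_d (p' u) (p' v) + (c + c) by lra.
apply: D2 => q; move: (hu q) (hv q) (D1' q); rewrite !ler_norml.
by move=> /andP[? ?] /andP[? ?] /andP[? ?]; apply/andP; split; lra.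
Qed.

Lemma profile0_dist u v : sup_dist (profile 0 u) (profile 0 v) (mm_d (phi u) (phi v)).
Proof.
have E w : profile 0 w = kX (phi w).
  apply/funext => q; rewrite /profile /mix /weight_case /= mul0r addr0.
  by case: ifP => h; rewrite ?h /= subr0 mul1r mul0r addr0.
rewrite !E; split=> [q|M hM]; first exact: (kurX_lip phi psi eps0 m0).
by have := hM (inl (phi v)); rewrite kurX_iso.
Qed.

(** At time 1 the jump threshold is 1, so on [0, 1) every point of the last [eps] has jumped. *)
Lemma profile1_dist u v : U u -> U v ->
  sup_dist (profile 1 u) (profile 1 v) (mm_d (psi u) (psi v)).
Proof.
have E w : U w -> profile 1 w = kY (psi w).
  move=> /andP[_ w1]; apply/funext => q; rewrite /profile /mix /weight_case /=.
  rewrite mul1r subrK w1; case: ifP => h /=; by rewrite subrr mul0r add0r mul1r.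
move=> uu uv; rewrite !E //; split=> [q|M hM]; first exact: (kurY_lip phi psi eps0 m0).
by have := hM (inr (psi v)); rewrite kurY_iso.
Qed.

End Interpolation.

(** * The geodesic between two spaces *)

Lemma box_geodesic (R : realType) (X0 X1 : mmspace R) :
  exists Xt : R -> mmspace R, Xt 0 = X0 /\ Xt 1 = X1 /\
    forall s t : R, 0 <= s <= 1 -> 0 <= t <= 1 ->
      box (Xt s) (Xt t) = `|s - t| * box X0 X1.
Proof.
have [phi [psi [Pphi Ppsi dist]]] := box_optimal X0 X1.
set eps := box X0 X1 in dist *.
have eps01 : 0 <= eps <= 1.
  by rewrite box_ge0 /=; apply: box_le; exact: box_admissible1.
(* At times 0 and 1 the spaces are [X0] and [X1] themselves, not isomorphic copies; outside [0, 1]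
   the choice of [X0] is arbitrary. *)
have /choice[Xt XtP] (t : R) : exists Z : mmspace R, [/\ t = 0 -> Z = X0, t = 1 -> Z = X1 &
    0 <= t <= 1 -> exists p : R -> Z, parameter p /\
      forall u v, unit_itv u -> unit_itv v ->
        sup_dist (profile phi psi eps t u) (profile phi psi eps t v) (mm_d (p u) (p v))].
  have [->|t0] := eqVneq t 0.
    exists X0; split=> // [/eqP|_]; first by rewrite eq_sym oner_eq0.
    by exists phi; split=> // u v _ _; exact: profile0_dist.
  have [->|t1] := eqVneq t 1.
    exists X1; split=> // [/eqP|_]; first by rewrite oner_eq0.
    by exists psi; split=> // u v uu uv; exact: profile1_dist.
  have [t01|nt] := pselect (0 <= t <= 1); last first.
    by exists X0; split=> // /eqP; rewrite (negbTE t1).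
  have [Z [p [Pp pD]]] := interpolation_space Pphi Ppsi eps01 dist t01.
  exists Z; split=> [/eqP|/eqP|_]; [by rewrite (negbTE t0)|by rewrite (negbTE t1)|].
  by exists p; split=> // u v _ _; exact: pD.
have Xt0 : Xt 0 = X0 by case: (XtP 0) => /(_ erefl).
have Xt1 : Xt 1 = X1 by case: (XtP 1) => _ /(_ erefl).
have le (s t : R) : 0 <= s -> s <= t -> t <= 1 -> box (Xt s) (Xt t) <= (t - s) * eps.
  move=> s0 st t1; apply: box_le.
  have [_ _] := XtP s; rewrite s0 (le_trans st t1) => /(_ erefl)[p [Pp pD]].
  have [_ _] := XtP t; rewrite (le_trans s0 st) t1 => /(_ erefl)[p' [Pp' pD']].
  have := interpolation_admissible eps01 dist s0 st t1 Pp Pp' pD pD'.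
  exact.
(* A strict inequality would make the route from [Xt 0] to [Xt 1] through [Xt s] and [Xt t] shorter
   than [eps]. *)
have eq (s t : R) : 0 <= s -> s <= t -> t <= 1 -> box (Xt s) (Xt t) = (t - s) * eps.
  move=> s0 st t1; apply/eqP; rewrite eq_le le //=.
  have h1 := le 0 s (lexx 0) s0 (le_trans st t1).
  have h2 := le t 1 (le_trans s0 st) t1 (lexx 1).
  have h3 := box_triangle (Xt 0) (Xt s) (Xt 1).
  have h4 := box_triangle (Xt s) (Xt t) (Xt 1).
  have h5 : box (Xt 0) (Xt 1) = eps by rewrite Xt0 Xt1.
  move: h1 h2; rewrite subr0 !mulrBl mul1r; lra.
exists Xt; split=> //; split=> // s t /andP[s0 s1] /andP[t0 t1].
have [st|/ltW ts] := leP s t.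
  by rewrite eq // ler0_norm ?subr_le0 // opprB.
by rewrite box_sym eq // ger0_norm ?subr_ge0.
Qed.

(** * Path connectedness of box balls *)

Unset Implicit Arguments.

Theorem theorem1p5 (R : realType) :
  (* geodesic: for all X0 X1 there is a path t |-> X_t with
     box(X_s, X_t) = |s - t| box(X0, X1) on [0,1] *)
  (forall X0 X1 : mmspace R,
     exists Xt : R -> mmspace R,
       Xt 0 = X0 /\ Xt 1 = X1 /\
       forall s t : R, 0 <= s <= 1 -> 0 <= t <= 1 ->
         box (Xt s) (Xt t) = `|s - t| * box X0 X1)
  /\
  (* local path connectedness: every open box-ball is path connected
     (by box-continuous paths on [0,1] staying inside the ball) *)
  (forall (X : mmspace R) (r : R), 0 < r ->
     forall Y Z : mmspace R, box X Y < r -> box X Z < r ->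
     exists g : R -> mmspace R,
       g 0 = Y /\ g 1 = Z /\
       (forall t, 0 <= t <= 1 -> box X (g t) < r) /\
       (forall t, 0 <= t <= 1 -> forall e : R, 0 < e ->
          exists del : R, 0 < del /\
            forall s, 0 <= s <= 1 -> `|s - t| < del -> box (g s) (g t) < e)).
Proof.
split; first exact: box_geodesic.
move=> X r r0 Y Z XY XZ.
have [A [A0 [A1 AP]]] := box_geodesic X Y.
have [B [B0 [B1 BP]]] := box_geodesic X Z.
have bXY := box_ge0 X Y; have bXZ := box_ge0 X Z.
(* The geodesic from [X] to [Y] run backwards, then the one from [X] to [Z]; they meet at [X] at
   time one half. *)
pose g t := if t <= 2^-1 then A (1 - 2 * t) else B (2 * t - 1).
have half (t : R) : 0 <= t <= 1 -> t <= 2^-1 -> 0 <= 1 - 2 * t <= 1.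
  by move=> /andP[? ?] ?; apply/andP; split; lra.
have half' (t : R) : 0 <= t <= 1 -> 2^-1 < t -> 0 <= 2 * t - 1 <= 1.
  by move=> /andP[? ?] ?; apply/andP; split; lra.
have zero01 : 0 <= (0 : R) <= 1 by rewrite lexx ler01.
have AX (t : R) : 0 <= t <= 1 -> box X (A t) = t * box X Y.
  move=> t01; rewrite -{1}A0 AP // sub0r normrN ger0_norm //; by case/andP: t01.
have BX (t : R) : 0 <= t <= 1 -> box X (B t) = t * box X Z.
  move=> t01; rewrite -{1}B0 BP // sub0r normrN ger0_norm //; by case/andP: t01.
have scale (t b : R) : 0 <= t <= 1 -> 0 <= b -> b < r -> t * b < r.
  by move=> /andP[t0 t1] b0 br; apply: le_lt_trans br; rewrite ler_piMl.
(* Each half runs at double speed along a geodesic of length below [r], whence the constant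
   [2 * r]. *)
have glip (s t : R) : 0 <= s <= 1 -> 0 <= t <= 1 -> s <= t ->
    box (g s) (g t) <= 2 * r * (t - s).
  move=> s01 t01 st; rewrite /g; have ts0 : 0 <= t - s by rewrite subr_ge0.
  have step (b : R) : 0 <= b -> b < r -> 2 * (t - s) * b <= 2 * r * (t - s).
    move=> b0 br; rewrite (_ : 2 * r * (t - s) = 2 * (t - s) * r); last by ring.
    by apply: ler_wpM2l; [exact: mulr_ge0|exact: ltW].
  have [hs|hs] := leP s 2^-1; have [ht|ht] := leP t 2^-1.
  - rewrite AP; [|exact: half|exact: half].
    rewrite (_ : 1 - 2 * s - (1 - 2 * t) = 2 * (t - s)); last by ring.
    by rewrite ger0_norm ?mulr_ge0 //; exact: step.
  (* For times on either side of one half, pass through [X]. *)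
  - apply: le_trans (box_triangle _ X _) _; rewrite box_sym AX ?half // BX ?half' //.
    have h1 : (1 - 2 * s) * box X Y <= (1 - 2 * s) * r.
      by apply: ler_wpM2l; [lra|exact: ltW].
    have h2 : (2 * t - 1) * box X Z <= (2 * t - 1) * r.
      by apply: ler_wpM2l; [lra|exact: ltW].
    by apply: le_trans (lerD h1 h2) _; rewrite -mulrDl le_eqVlt; apply/orP; left; apply/eqP; ring.
  - by exfalso; lra.
  - rewrite BP; [|exact: half'|exact: half'].
    rewrite (_ : 2 * s - 1 - (2 * t - 1) = - (2 * (t - s))); last by ring.
    by rewrite normrN ger0_norm ?mulr_ge0 //; exact: step.
exists g; split.
  by rewrite /g ifT ?invr_ge0 // mulr0 subr0.
split.
  rewrite /g ifF ?mulr1; first by rewrite (_ : 2 - 1 = 1 :> R) //; ring.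
  by apply/negbTE; rewrite -ltNge; lra.
split=> [t t01|t t01 e e0].
  rewrite /g; have [ht|ht] := leP t 2^-1; first by rewrite AX ?half // scale ?half.
  by rewrite BX ?half' // scale ?half'.
exists (e / (2 * r)); split; first by rewrite divr_gt0 ?mulr_gt0.
move=> s s01; rewrite ltr_pdivlMr ?mulr_gt0 // => st.
have [le_st|/ltW le_ts] := leP s t.
  apply: le_lt_trans (glip _ _ s01 t01 le_st) _.
  by move: st; rewrite distrC ger0_norm ?subr_ge0 // mulrC.
rewrite box_sym; apply: le_lt_trans (glip _ _ t01 s01 le_ts) _.
by move: st; rewrite ger0_norm ?subr_ge0 // mulrC.
Qed.
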